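(* We have $$\sum_{n=0}^\infty\sum_{m=-\infty}^\infty M_4(m,2n+1)z^mq^{2n+1}=\frac{2q\,(-zq^8,-q^8/z;q^8)_\infty\,(q^4;q^4)_\infty^4\,(q^8;q^8)_\infty}{(zq^4,q^4/z;q^4)_\infty\,(q^2;q^2)_\infty^4}.$$
   Context: Here $(w;q)_\infty=\prod_{k\ge0}(1-wq^k)$ and $(w_1,w_2;q)_\infty=(w_1;q)_\infty(w_2;q)_\infty$. For a positive integer $d$, the numbers $M_d(m,n)$ are the coefficients of $z^mq^n$ in $$\mathcal{O}_d(z;q)=\sum_{n=0}^\infty\sum_{m=-\infty}^\infty M_d(m,n)z^mq^n=\frac{(-q;q)_\infty}{(q;q)_\infty}\left(1+2\sum_{n\ge1}\frac{(1-z)(1-z^{-1})(-1)^nq^{n^2+dn}}{(1-zq^{dn})(1-z^{-1}q^{dn})}\right),$$ expanded as a power series in $q$ whose coefficients are Laurent polynomials in $z$. *)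

(* Defs.v *)
From HB Require Import structures.
From mathcomp Require Import all_boot all_order all_algebra.
From mathcomp Require Import all_classical.

Set Implicit Arguments.
Unset Strict Implicit.
Unset Printing Implicit Defensive.

Import Order.TTheory GRing.Theory Num.Theory.

Local Open Scope classical_set_scope.
Local Open Scope ring_scope.

(* Z[z, 1/z]: the finitely supported functions m |-> coefficient of z^m. *)
Record laurent := Laurent {
  lcoef :> int -> int;
  lcoef_fin : finite_set [set m | lcoef m != 0] }.

HB.instance Definition _ := gen_eqMixin laurent.
HB.instance Definition _ := gen_choiceMixin laurent.

Lemma laurentP (p r : laurent) : (forall m, p m = r m) -> p = r.
Proof.
case: p r => [p fp] [r fr] /= /funext e; move: fp fr.
by rewrite e => fp fr; congr Laurent; exact: Prop_irrelevance.
Qed.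

Section LaurentRing.
Implicit Types p r s : laurent.

Lemma lsupp_seq p : exists2 S : seq int, uniq S & forall m, p m != 0 -> m \in S.
Proof.
have /finite_seqP[S eS] := lcoef_fin p; exists (undup S); first exact: undup_uniq.
by move=> m pm; rewrite mem_undup; have : [set` S] m by rewrite -eS.
Qed.

Lemma lsupp_seq2 p r : exists2 S : seq int, uniq S &
  forall m, (p m != 0) || (r m != 0) -> m \in S.
Proof.
have [S _ pS] := lsupp_seq p; have [S' _ rS] := lsupp_seq r.
exists (undup (S ++ S')); first exact: undup_uniq.
by move=> m; rewrite mem_undup mem_cat => /orP[/pS ->|/rS ->]; rewrite ?orbT.
Qed.

Lemma seq_fin (f : int -> int) (S : seq int) :
  (forall m, f m != 0 -> m \in S) -> finite_set [set m | f m != 0].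
Proof.
move=> fS; apply: (@sub_finite_set _ _ [set` S]); last exact: finite_seq.
by move=> m /fS.
Qed.

Lemma lmono_fin k : finite_set [set m : int | (m == k)%:Z != 0].
Proof.
by apply: (@seq_fin _ [:: k]) => m; rewrite inE; case: (m == k).
Qed.

(* z^k *)
Definition lmono k := Laurent (lmono_fin k).

Lemma lzero_fin : finite_set [set m : int | (0 : int) != 0].
Proof. by apply: (@seq_fin (fun=> 0) [::]) => m; rewrite eqxx. Qed.
Definition lzero := Laurent lzero_fin.

Lemma lopp_fin p : finite_set [set m | - p m != 0].
Proof.
have [S _ pS] := lsupp_seq p; apply: (@seq_fin (fun m => - p m) S) => m.
by rewrite oppr_eq0; exact: pS.
Qed.
Definition lopp p := Laurent (lopp_fin p).

Lemma ladd_fin p r : finite_set [set m | p m + r m != 0].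
Proof.
have [S _ pS] := lsupp_seq2 p r; apply: (@seq_fin (fun m => p m + r m) S) => m.
move=> h; apply: pS; apply: contraNT h; rewrite negb_or !negbK.
by move=> /andP[/eqP-> /eqP->]; rewrite addr0.
Qed.
Definition ladd p r := Laurent (ladd_fin p r).

Definition lmul_fun p r (m : int) : int := \sum_(i \in [set: int]) p i * r (m - i).

Lemma lmul_funE p r S m : uniq S -> (forall i, p i != 0 -> i \in S) ->
  lmul_fun p r m = \sum_(i <- S) p i * r (m - i).
Proof.
move=> uS pS; rewrite (fsbig_seq _ _ uS) /lmul_fun; symmetry; apply: fsbig_widen => //.
move=> i [_] /= iS; case: (eqVneq (p i) 0) => [->|/pS //].
  by rewrite mul0r.
Qed.

Lemma lmul_fin p r : finite_set [set m | lmul_fun p r m != 0].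
Proof.
have [S uS pS] := lsupp_seq p; have [S' _ rS] := lsupp_seq r.
apply: (@seq_fin _ [seq i + j | i <- S, j <- S']) => m; apply: contraNT => mN.
rewrite (lmul_funE _ _ uS pS) big1_seq // => i /andP[_ iS].
case: (eqVneq (r (m - i)) 0) => [->|/rS h]; first by rewrite mulr0.
case/negP: mN; apply/allpairsP; exists (i, m - i); split=> //=.
by rewrite addrC subrK.
Qed.
Definition lmul p r := Laurent (lmul_fin p r).

Lemma laddA : associative ladd.
Proof. by move=> p r s; apply: laurentP => m /=; rewrite addrA. Qed.
Lemma laddC : commutative ladd.
Proof. by move=> p r; apply: laurentP => m /=; rewrite addrC. Qed.
Lemma ladd0 : left_id lzero ladd.
Proof. by move=> p; apply: laurentP => m /=; rewrite add0r. Qed.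
Lemma laddN : left_inverse lzero lopp ladd.
Proof. by move=> p; apply: laurentP => m /=; rewrite addNr. Qed.

HB.instance Definition _ := GRing.isZmodule.Build laurent laddA laddC ladd0 laddN.

Lemma lmulC : commutative lmul.
Proof.
move=> p r; apply: laurentP => m /=; rewrite /lmul_fun.
have bij : bijective (fun i : int => m - i).
  by exists (fun i => m - i) => i; rewrite subKr.
transitivity (\sum_(i \in [set: int]) r (m - i) * p (m - (m - i))).
  by apply: eq_fsbigr => i _; rewrite subKr mulrC.
by symmetry; apply: (reindex_fsbigT (fun i : int => m - i)).
Qed.

Lemma lmulA : associative lmul.
Proof.
move=> p r s; rewrite (lmulC r s) (lmulC (lmul p r) s); apply: laurentP => m /=.
have [Sp up hp] := lsupp_seq p; have [Ss us hs] := lsupp_seq s.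
rewrite (lmul_funE _ _ up hp) (lmul_funE _ _ us hs) /=.
under eq_bigr do rewrite (lmul_funE _ _ us hs) big_distrr.
under [RHS]eq_bigr do rewrite (lmul_funE _ _ up hp) big_distrr.
rewrite exchange_big /=; apply: eq_bigr => i _; apply: eq_bigr => j _.
by rewrite mulrCA addrAC.
Qed.

Lemma lmul1 : left_id (lmono 0) lmul.
Proof.
move=> p; apply: laurentP => m /=.
rewrite (@lmul_funE _ _ [:: 0]) //=; last by move=> i; rewrite inE; case: (i == 0).
by rewrite big_seq1 eqxx mul1r subr0.
Qed.

Lemma lmulDl : left_distributive lmul ladd.
Proof.
move=> p r s; apply: laurentP => m /=; have [S uS hS] := lsupp_seq2 p r.
rewrite !(@lmul_funE _ _ S) // => [|i h|i h|i /= h].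
- by rewrite -big_split; apply: eq_bigr => i _ /=; rewrite mulrDl.
- by apply: hS; rewrite h orbT.
- by apply: hS; rewrite h.
- apply: hS; apply: contraNT h; rewrite negb_or !negbK.
  by move=> /andP[/eqP-> /eqP->]; rewrite addr0.
Qed.

Lemma lone_neq0 : lmono 0 != 0.
Proof. by apply/eqP => /(congr1 (fun p : laurent => p 0)). Qed.

HB.instance Definition _ :=
  GRing.Zmodule_isComNzRing.Build laurent lmulA lmulC lmul1 lmulDl lone_neq0.

End LaurentRing.

(* The ring R[[q]]; fcoef f n is the coefficient of q^n. *)
Record fps (R : Type) := Fps { fcoef :> nat -> R }.

HB.instance Definition _ R := gen_eqMixin (fps R).
HB.instance Definition _ R := gen_choiceMixin (fps R).

Lemma fpsP R (f g : fps R) : (forall n, f n = g n) -> f = g.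
Proof. by case: f g => [f] [g] /= /funext ->. Qed.

Section FpsRing.
Variable R : comNzRingType.
Implicit Types (f g h : fps R) (c : R).

Definition fzero : fps R := Fps (fun=> 0).
Definition fopp f : fps R := Fps (fun n => - f n).
Definition fadd f g : fps R := Fps (fun n => f n + g n).
Definition fpsC c : fps R := Fps (fun n => if n == 0%N then c else 0).
Definition fmul f g : fps R :=
  Fps (fun n => \sum_(i < n.+1) f i * g (n - i)%N).

Lemma faddA : associative fadd.
Proof. by move=> f g h; apply: fpsP => n /=; rewrite addrA. Qed.
Lemma faddC : commutative fadd.
Proof. by move=> f g; apply: fpsP => n /=; rewrite addrC. Qed.
Lemma fadd0 : left_id fzero fadd.
Proof. by move=> f; apply: fpsP => n /=; rewrite add0r. Qed.
Lemma faddN : left_inverse fzero fopp fadd.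
Proof. by move=> f; apply: fpsP => n /=; rewrite addNr. Qed.

HB.instance Definition _ := GRing.isZmodule.Build (fps R) faddA faddC fadd0 faddN.

Let trunc N f : {poly R} := \poly_(i < N.+1) f i.

Let coef_trunc N f n : (n <= N)%N -> (trunc N f)`_n = f n.
Proof. by move=> le_nN; rewrite coef_poly ltnS le_nN. Qed.

Let fmul_poly N f g (p r : {poly R}) n : (n <= N)%N ->
  (forall i, (i <= N)%N -> p`_i = f i) -> (forall i, (i <= N)%N -> r`_i = g i) ->
  (p * r)`_n = fmul f g n.
Proof.
move=> nN pf rg; rewrite coefM; apply: eq_bigr => i _.
rewrite pf ?rg //; first exact: leq_trans (leq_subr _ _) nN.
by apply: leq_trans nN; rewrite -ltnS.
Qed.

Let coef_truncM N f g n : (n <= N)%N ->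
  (trunc N f * trunc N g)`_n = fmul f g n.
Proof. by move=> nN; apply: (fmul_poly nN) => i; exact: coef_trunc. Qed.

Lemma fmulC : commutative fmul.
Proof. by move=> f g; apply: fpsP => n; rewrite -!(coef_truncM _ _ (leqnn n)) mulrC. Qed.

Lemma fmulA : associative fmul.
Proof.
move=> f g h; apply: fpsP => n.
transitivity ((trunc n f * (trunc n g * trunc n h))`_n).
  symmetry; apply: (fmul_poly (leqnn n)) => i; first exact: coef_trunc.
  exact: coef_truncM.
rewrite mulrA; apply: (fmul_poly (leqnn n)) => i; last exact: coef_trunc.
exact: coef_truncM.
Qed.

Lemma fmul1 : left_id (fpsC 1) fmul.
Proof.
move=> f; apply: fpsP => n /=; rewrite big_ord_recl /= mul1r subn0 big1 ?addr0 //.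
by move=> i _; rewrite mul0r.
Qed.

Lemma fmulDl : left_distributive fmul fadd.
Proof.
move=> f g h; apply: fpsP => n /=; rewrite -big_split.
by apply: eq_bigr => i _; rewrite /= mulrDl.
Qed.

Lemma fone_neq0 : fpsC 1 != 0.
Proof. by apply/eqP => /(congr1 (fun f : fps R => f 0%N)) /eqP; rewrite oner_eq0. Qed.

HB.instance Definition _ :=
  GRing.Zmodule_isComNzRing.Build (fps R) fmulA fmulC fmul1 fmulDl fone_neq0.

Definition funit : {pred fps R} := fun f => `[< exists g, g * f = 1 >].
Definition finv f : fps R := xget f [set g | g * f = 1].

Lemma fmulV : {in funit, left_inverse 1 finv *%R}.
Proof. by move=> f /asboolP/(xgetPex f). Qed.
Lemma funitP f g : g * f = 1 -> funit f.
Proof. by move=> gf; apply/asboolP; exists g. Qed.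
Lemma finv_out : {in [predC funit], finv =1 id}.
Proof.
by move=> f /negP fN; apply: xgetPN => g gf; apply: fN; exact: funitP gf.
Qed.

HB.instance Definition _ :=
  GRing.ComNzRing_hasMulInverse.Build (fps R) fmulV funitP finv_out.

Definition fpsX : fps R := Fps (fun n => (n == 1%N)%:R).

(* The q-adic limit: each coefficient takes its eventual value (0 if it is not
   eventually constant). *)
Definition fps_lim (u : nat -> fps R) : fps R :=
  Fps (fun n => xget 0
    [set c | exists N, forall k, (N <= k)%N -> u k n = c]).

Lemma fps_limE (u : nat -> fps R) f :
  (forall n, exists N, forall k, (N <= k)%N -> u k n = f n) -> fps_lim u = f.
Proof.
move=> uf; apply: fpsP => n /=; apply: xget_unique; first exact: uf.
move=> c [N1 h1]; have [N2 h2] := uf n.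
by rewrite -(h1 (maxn N1 N2)) ?leq_maxl// h2 // leq_maxr.
Qed.

Definition fps_sum (F : nat -> fps R) : fps R :=
  fps_lim (fun N => \sum_(0 <= n < N) F n).
Definition fps_prod (F : nat -> fps R) : fps R :=
  fps_lim (fun N => \prod_(0 <= n < N) F n).

(* (w; s)_oo *)
Definition qpoch (w s : fps R) : fps R := fps_prod (fun k => 1 - w * s ^+ k).

(* (w1, w2; s)_oo *)
Definition qpoch2 (w1 w2 s : fps R) : fps R := qpoch w1 s * qpoch w2 s.

End FpsRing.

Definition q : fps laurent := fpsX laurent.
Definition z : fps laurent := fpsC (lmono 1).

(* O_d(z; q); the sum over n >= 1 is indexed from 0, with n.+1 for n. *)
Definition overrank (d : nat) : fps laurent :=
  qpoch (- q) q / qpoch q q *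
  (1 + 2 * fps_sum (fun n' => let n := n'.+1 in
     (1 - z) * (1 - z^-1) * (-1) ^+ n * q ^+ (n ^ 2 + d * n)%N /
     ((1 - z * q ^+ (d * n)%N) * (1 - z^-1 * q ^+ (d * n)%N)))).

Definition M (d : nat) (m : int) (n : nat) : int := lcoef (fcoef (overrank d) n) m.

(* Main.v *)
Require Import Defs.
From HB Require Import structures.
From mathcomp Require Import all_boot all_order all_algebra.
From mathcomp Require Import all_classical.
From mathcomp Require Import zify ring.
Set Implicit Arguments.
Unset Strict Implicit.
Unset Printing Implicit Defensive.
Import Order.TTheory GRing.Theory Num.Theory.
Local Open Scope classical_set_scope.
Local Open Scope ring_scope.

(**
The terms of the rank sum with [n] odd (resp. even) are odd (resp. even) in q,
and with [t = q ^ 4] they equal [q] times (resp. equal)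
[- t ^ (m ^ 2 + 3 m + 1) D_0 / D_n] with [n = 2 m + 1] (resp.
[t ^ (m ^ 2 + 2 m) D_0 / D_n] with [n = 2 m]), where
[D_k = (1 - z t ^ k) (1 - t ^ k / z)].  The series [1 / phi (- q)] in front of
the sum is dissected through [phi (q) = phi (q ^ 4) + 2 q psi (q ^ 8)].  The odd
part is then a combination of the two sums which is, up to a factor, the partial
fraction expansion of [(- z t ^ 2, - t ^ 2 / z; t ^ 2) / (z t, t / z; t)].

That expansion is obtained from a finite one: with N and 2 N factors, the product
is a rational function of [y = z + 1 / z] with simple poles at
[y = t ^ k + t ^ (- k)], and Lagrange interpolation at these points (and at
[y = 2], the zero of [D_0]) gives its residues.  The limit N -> oo is taken
q-adically, term by term; phi and psi are treated likewise, starting from the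
q-binomial theorem.
*)

(** * q-adic limits and infinite products *)

Section Adic.
Variable R : comNzRingType.
Implicit Types (f g h w s t : fps R) (u v : nat -> fps R).

Lemma fps_addE f g n : (f + g) n = f n + g n. Proof. by []. Qed.
Lemma fps_oppE f n : (- f) n = - f n. Proof. by []. Qed.
Lemma fps_mulE f g n : (f * g) n = \sum_(i < n.+1) f i * g (n - i)%N.
Proof. by []. Qed.
Lemma fps_mul0E f g : (f * g) 0%N = f 0%N * g 0%N.
Proof. by rewrite fps_mulE big_ord1. Qed.

Lemma fps_sumE (I : Type) (r : seq I) (F : I -> fps R) n :
  (\sum_(i <- r) F i) n = \sum_(i <- r) F i n.
Proof. by elim/big_rec2: _ => // i x y _ <-. Qed.

(** Membership in the ideal generated by the [n]-th power of the variable; all q-adic estimates are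
    phrased through it. *)
Definition vanish n f := forall i, (i < n)%N -> f i = 0.

Lemma vanishD n f g : vanish n f -> vanish n g -> vanish n (f + g).
Proof. by move=> vf vg i lti; rewrite fps_addE vf // vg // addr0. Qed.

Lemma vanishN n f : vanish n f -> vanish n (- f).
Proof. by move=> vf i lti; rewrite fps_oppE vf // oppr0. Qed.

Lemma vanishB n f g : vanish n f -> vanish n g -> vanish n (f - g).
Proof. by move=> vf vg; apply/vanishD/vanishN. Qed.

Lemma vanish_le m n f : (m <= n)%N -> vanish n f -> vanish m f.
Proof. by move=> lemn vf i lti; apply: vf; apply: leq_trans lemn. Qed.

Lemma vanishM m n f g : vanish m f -> vanish n g -> vanish (m + n) (f * g).
Proof.
move=> vf vg i lti; rewrite fps_mulE big1 // => j _.
have [ltj|lej] := ltnP j m; first by rewrite vf ?mul0r.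
by rewrite vg ?mulr0 //; have := ltn_ord j; lia.
Qed.

Lemma vanishMl n f g : vanish n g -> vanish n (f * g).
Proof. exact: (@vanishM 0 n). Qed.

Lemma vanishMr n f g : vanish n f -> vanish n (f * g).
Proof. by rewrite mulrC; apply: vanishMl. Qed.

Lemma vanishX n f : vanish 1 f -> vanish n (f ^+ n).
Proof.
move=> vf; elim: n => [//|n IHn]; rewrite exprS -add1n.
exact: vanishM.
Qed.

Lemma vanish_sum (I : Type) (r : seq I) (P : pred I) (F : I -> fps R) n :
  (forall i, P i -> vanish n (F i)) -> vanish n (\sum_(i <- r | P i) F i).
Proof.
move=> vF; apply: big_ind => //; exact: vanishD.
Qed.

Lemma vanish_tail (F : nat -> fps R) m n : (m <= n)%N ->
  (forall k, vanish k (F k)) ->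
  vanish m (\sum_(0 <= k < n) F k - \sum_(0 <= k < m) F k).
Proof.
move=> + vF; elim: n => [|n IHn]; first by rewrite leqn0 => /eqP ->; rewrite subrr.
rewrite leq_eqVlt => /predU1P[->|lemn]; first by rewrite subrr.
rewrite big_nat_recr //= addrAC; apply: vanishD; first exact: IHn.
exact: vanish_le (vF n).
Qed.

(** With [h = 1 - f] divisible by the variable, the inverse is the geometric series of [h]; its
    [n]-th coefficient is already that of the sum of [h ^+ i] over [i <= n]. *)
Lemma fps_unit f : f 0%N = 1 -> f \is a GRing.unit.
Proof.
move=> f1; have [h fE] : exists h, f = 1 - h by exists (1 - f); rewrite subKr.
have vh : vanish 1 h by case=> // _; move: f1; rewrite fE fps_addE fps_oppE => /eqP;
  rewrite subr_eq addrC -subr_eq subrr eq_sym => /eqP.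
pose g := Fps (fun n => (\sum_(i < n.+1) h ^+ i) n).
have gE n : vanish n.+1 (g - \sum_(i < n.+1) h ^+ i).
  move=> i lti; rewrite fps_addE fps_oppE /= -!(big_mkord xpredT (fun j => h ^+ j)).
  have /(_ i (ltnSn i)) := vanish_tail lti (fun j => vanishX (n := j) vh).
  by rewrite fps_addE fps_oppE => /eqP; rewrite subr_eq0 eq_sym -subr_eq0 => /eqP.
apply/unitrPr; exists g; apply: fpsP => n.
rewrite fE.
rewrite -[g](subrK (\sum_(i < n.+1) h ^+ i)) mulrDr fps_addE.
rewrite (vanishMl _ (gE n)) // add0r.
have -> : (1 - h) * (\sum_(i < n.+1) h ^+ i) = 1 - h ^+ n.+1.
  by rewrite -[RHS]opprB subrX1 -mulNr opprB.
by rewrite fps_addE fps_oppE (vanishX vh) // subr0.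
Qed.

(** Convergence in the q-adic topology. [fps_lim] returns 0 on coefficients that do not stabilise,
    so it is this relation that carries actual convergence. *)
Definition fcvg u f :=
  forall n, exists N, forall k, (N <= k)%N -> vanish n (u k - f).

Lemma fcvg_lim u f : fcvg u f -> fps_lim u = f.
Proof.
move=> uf; apply: fps_limE => n; have [N hN] := uf n.+1.
by exists N => k /hN /(_ n (ltnSn n)) /eqP; rewrite subr_eq0 => /eqP.
Qed.

Lemma fcvg_unique u f g : fcvg u f -> fcvg u g -> f = g.
Proof. by move=> /fcvg_lim <- /fcvg_lim. Qed.

Lemma eq_fcvg u v f : u =1 v -> fcvg u f -> fcvg v f.
Proof. by move=> /funext ->. Qed.

Lemma eq_fcvg_near m u v f : (forall k, (m <= k)%N -> u k = v k) ->
  fcvg u f -> fcvg v f.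
Proof.
move=> uv uf n; have [N hN] := uf n; exists (maxn m N) => k.
by rewrite geq_max => /andP[/uv <-]; apply: hN.
Qed.

Lemma fcvg_cst f : fcvg (fun=> f) f.
Proof. by move=> n; exists 0%N => k _; rewrite subrr. Qed.

Lemma fcvgD u v f g : fcvg u f -> fcvg v g -> fcvg (fun k => u k + v k) (f + g).
Proof.
move=> uf vg n; have [N hN] := uf n; have [N' hN'] := vg n.
exists (maxn N N') => k; rewrite geq_max => /andP[lek lek'].
by rewrite opprD addrACA; apply: vanishD; [apply: hN | apply: hN'].
Qed.

Lemma fcvgM u v f g : fcvg u f -> fcvg v g -> fcvg (fun k => u k * v k) (f * g).
Proof.
move=> uf vg n; have [N hN] := uf n; have [N' hN'] := vg n.
exists (maxn N N') => k; rewrite geq_max => /andP[lek lek'].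
have -> : u k * v k - f * g = (u k - f) * v k + f * (v k - g) by ring.
by apply: vanishD; [apply/vanishMr/hN | apply/vanishMl/hN'].
Qed.

Lemma fcvgV u f : (forall k, u k \is a GRing.unit) -> f \is a GRing.unit ->
  fcvg u f -> fcvg (fun k => (u k)^-1) f^-1.
Proof.
move=> uU fU uf n; have [N hN] := uf n; exists N => k /hN vk.
have -> : (u k)^-1 - f^-1 = - ((u k)^-1 * f^-1 * (u k - f)).
  by rewrite mulrBr mulrAC mulVr // mul1r divrK // opprB.
exact/vanishN/vanishMl.
Qed.

(** The index map [phi] lags behind the identity by at most [m], hence tends to infinity. *)
Lemma fcvg_comp u f (phi : nat -> nat) m : (forall k, m <= k -> k <= phi k + m)%N ->
  fcvg u f -> fcvg (u \o phi) f.
Proof.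
move=> lephi uf n; have [N hN] := uf n; exists (N + m)%N => k lek.
by apply: hN; have := lephi k; lia.
Qed.

(** The [n]-th coefficient no longer changes from index [n.+1] on, so the diagonal series [f] is the
    limit. *)
Lemma fcvg_Cauchy u : (forall n, vanish n (u n.+1 - u n)) -> fcvg u (fps_lim u).
Proof.
move=> du; pose f := Fps (fun n => u n.+1 n).
have uE n k : (n <= k)%N -> vanish n (u k - u n).
  elim: k => [|k IHk]; first by rewrite leqn0 => /eqP ->.
  rewrite leq_eqVlt => /predU1P[->|lenk]; first by rewrite subrr.
  rewrite -(subrKA (u k)); apply: vanishD; last exact: IHk.
  by apply: vanish_le (du k).
suff uf : fcvg u f by rewrite (fcvg_lim uf).
move=> n; exists n => k lenk i lti; rewrite fps_addE fps_oppE /=.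
have := uE i.+1 k (leq_trans lti lenk) i (ltnSn i).
by rewrite fps_addE fps_oppE.
Qed.

Lemma fcvg_sum (F : nat -> fps R) : (forall n, vanish n (F n)) ->
  fcvg (fun N => \sum_(0 <= n < N) F n) (fps_sum F).
Proof.
move=> vF; apply: fcvg_Cauchy => n.
by rewrite big_nat_recr //= addrAC subrr add0r.
Qed.

Lemma fps_sumZ c (F : nat -> fps R) : (forall n, vanish n (F n)) ->
  fps_sum (fun n => c * F n) = c * fps_sum F.
Proof.
move=> vF; have vcF n : vanish n (c * F n) by apply: vanishMl.
apply: fcvg_unique (fcvg_sum vcF) _.
by apply: eq_fcvg (fcvgM (fcvg_cst c) (fcvg_sum vF)) => N; rewrite mulr_sumr.
Qed.

Lemma fps_sum_even_odd (F : nat -> fps R) : (forall n, vanish n (F n)) ->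
  fps_sum F = fps_sum (fun n => F n.*2) + fps_sum (fun n => F n.*2.+1).
Proof.
move=> vF; have leD n : (n <= n.*2)%N by rewrite -addnn leq_addr.
have v0 n : vanish n (F n.*2) by apply: vanish_le (vF _).
have v1 n : vanish n (F n.*2.+1) by apply: vanish_le (vF _); apply: leqW.
apply: fcvg_unique (fcvgD (fcvg_sum v0) (fcvg_sum v1)).
apply: eq_fcvg (fcvg_comp (phi := double) (m := 0) _ (fcvg_sum vF)) => [N|k _].
  rewrite /=; elim: N => [|N IHN]; first by rewrite !big_geq // addr0.
  by rewrite doubleS !big_nat_recr //= IHN addrACA addrA.
by rewrite addn0.
Qed.

Lemma fcvg_vanish u f n : (forall k, vanish n (u k)) -> fcvg u f -> vanish n f.
Proof.
move=> vu uf; have [N hN] := uf n.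
rewrite -[f](subKr (u N)); apply: vanishB; [exact: vu | exact: hN].
Qed.

(** Dominated convergence: the bound [vanish k (F N k)], uniform in [N], leaves only the terms
    [k < n] modulo the [n]-th power of the variable, and these are finitely many. *)
Lemma fcvg_Tannery (F : nat -> nat -> fps R) (f : nat -> fps R) (b : nat -> nat) :
  (forall N, (N <= b N)%N) -> (forall N k, vanish k (F N k)) ->
  (forall k, fcvg (F ^~ k) (f k)) ->
  fcvg (fun N => \sum_(0 <= k < b N) F N k) (fps_sum f).
Proof.
move=> leb vF Ff n.
have vf k : vanish k (f k) by apply: fcvg_vanish (Ff k) => N; apply: vF.
(* One threshold serves all [k < n]: the maximum of finitely many. *)
have [N0 hN0] : exists N0, forall k N, (k < n)%N -> (N0 <= N)%N ->
    vanish n (F N k - f k).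
  elim: {-2}n => [|m [N0 hN0]]; first by exists 0%N.
  have [N1 hN1] := Ff m n; exists (maxn N0 N1) => k N ltk.
  rewrite geq_max => /andP[le0 le1].
  by move: ltk; rewrite ltnS leq_eqVlt => /predU1P[->|ltk]; [apply: hN1|apply: hN0].
have [N1 hN1] := fcvg_sum vf n.
exists (maxn n N0) => N; rewrite geq_max => /andP[len le0].
have lenb : (n <= b N)%N by apply: leq_trans (leb N).
have fsE : vanish n (fps_sum f - \sum_(0 <= k < n) f k).
  have := vanish_tail (leq_maxl n N1) vf.
  move=> /vanishB /(_ (hN1 _ (leq_maxr n N1))).
  by rewrite opprB addrC addrA subrK.
rewrite -(subrKA (\sum_(0 <= k < n) F N k)); apply: vanishD.
  exact: vanish_tail.
rewrite -(subrKA (\sum_(0 <= k < n) f k)); apply: vanishD; last first.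
  by rewrite -opprB; apply: vanishN.
rewrite -sumrB big_nat_cond; apply: vanish_sum => k /andP[/andP[_ ltk] _].
exact: hN0.
Qed.

End Adic.

(** * Finite q-shifted factorials and their limits *)

Definition qfac (A : comNzRingType) (w s : A) n := \prod_(0 <= k < n) (1 - w * s ^+ k).

Section QFacRing.
Variable A : comNzRingType.
Implicit Types w s : A.

Lemma qfac0 w s : qfac w s 0 = 1.
Proof. by rewrite /qfac big_geq. Qed.

Lemma qfacS w s n : qfac w s n.+1 = qfac w s n * (1 - w * s ^+ n).
Proof. by rewrite /qfac big_nat_recr. Qed.

Lemma qfac_add w s m n : qfac w s (m + n) = qfac w s m * qfac (w * s ^+ m) s n.
Proof.
elim: n => [|n IHn]; first by rewrite addn0 qfac0 mulr1.
by rewrite addnS !qfacS IHn exprD !mulrA.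
Qed.

End QFacRing.

Lemma rmorph_qfac (A B : comNzRingType) (f : {rmorphism A -> B}) w s n :
  f (qfac w s n) = qfac (f w) (f s) n.
Proof.
rewrite /qfac rmorph_prod; apply: eq_bigr => k _.
by rewrite rmorphB rmorph1 rmorphM rmorphXn.
Qed.

Section QPoch.
Variable R : comNzRingType.
Implicit Types (f g h w s t : fps R).

Lemma qfac_cvg w s : vanish 1 s -> fcvg (qfac w s) (qpoch w s).
Proof.
move=> vs; suff dq n : vanish n (qfac w s n.+1 - qfac w s n) by exact: fcvg_Cauchy dq.
rewrite qfacS mulrBr mulr1 addrAC subrr add0r.
exact/vanishN/vanishMl/vanishMl/vanishX.
Qed.

Lemma fcvg_qfac_sub w s m : vanish 1 s ->
  fcvg (fun N => qfac w s (N.*2 - m)) (qpoch w s).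
Proof.
by move=> vs; apply: (fcvg_comp (m := m)) (qfac_cvg w vs) => k _; lia.
Qed.

Lemma fcvg_qfac_add w s m : vanish 1 s ->
  fcvg (fun N => qfac w s (N.*2 + m)) (qpoch w s).
Proof.
by move=> vs; apply: (fcvg_comp (m := 0)) (qfac_cvg w vs) => k _; lia.
Qed.

Lemma qfac_const w s n : vanish 1 w -> qfac w s n 0%N = 1.
Proof.
move=> vw; elim: n => [|n IHn]; first by rewrite qfac0.
by rewrite qfacS fps_mul0E IHn mul1r fps_addE fps_oppE fps_mul0E vw // mul0r subr0.
Qed.

Lemma qpoch_const w s : vanish 1 s -> vanish 1 w -> qpoch w s 0%N = 1.
Proof.
move=> vs vw; have [N hN] := qfac_cvg w vs 1%N.
have := hN N (leqnn N) 0%N isT; rewrite fps_addE fps_oppE qfac_const //.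
by move/eqP; rewrite subr_eq0 => /eqP.
Qed.

Lemma qfac_unit w s n : vanish 1 w -> qfac w s n \is a GRing.unit.
Proof. by move=> vw; apply/fps_unit/qfac_const. Qed.

Lemma qpoch_unit w s : vanish 1 s -> vanish 1 w -> qpoch w s \is a GRing.unit.
Proof. by move=> vs vw; apply/fps_unit/qpoch_const. Qed.

Lemma qpoch_even_odd w s : vanish 1 s ->
  qpoch w s = qpoch w (s ^+ 2) * qpoch (w * s) (s ^+ 2).
Proof.
move=> vs; have vs2 : vanish 1 (s ^+ 2) by apply/(vanish_le (n := 2))/vanishX.
have h := fcvgM (qfac_cvg w vs2) (qfac_cvg (w * s) vs2).
apply: fcvg_unique h; apply: eq_fcvg (_ : fcvg (qfac w s \o double) _) => [n|].
  rewrite /=; elim: n => [|n IHn]; first by rewrite double0 !qfac0 mulr1.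
  rewrite doubleS !qfacS IHn -!exprM -mul2n [s ^+ (2 * n).+1]exprS.
  by ring.
by apply: (fcvg_comp (m := 0)) (qfac_cvg _ vs) => k _; lia.
Qed.

Lemma qpoch_opp_mul s : vanish 1 s ->
  qpoch (- s) s * qpoch s s = qpoch (s ^+ 2) (s ^+ 2).
Proof.
move=> vs; have vs2 : vanish 1 (s ^+ 2) by apply/(vanish_le (n := 2))/vanishX.
apply: fcvg_unique (qfac_cvg _ vs2).
apply: eq_fcvg (fcvgM (qfac_cvg _ vs) (qfac_cvg _ vs)) => n.
elim: n => [|n IHn]; first by rewrite !qfac0 mulr1.
by rewrite !qfacS -IHn -exprM mulnC exprM; ring.
Qed.

End QPoch.

(** * The q-binomial theorem and theta series *)

Section Fold.
Variables (T : Type) (idx : T) (op : Monoid.com_law idx).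

(** Folding about the centre pairs indices symmetric to each other; this makes the two-sided
    symmetry of theta products and theta sums visible on ranges starting at 0. *)
Lemma big_nat_fold (g : nat -> T) M : \big[op/idx]_(0 <= k < M.*2) g k =
  \big[op/idx]_(0 <= m < M) op (g (M + m)%N) (g (M - m.+1)%N).
Proof.
rewrite (@big_cat_nat _ _ _ M) //=; last by rewrite -addnn leq_addr.
rewrite Monoid.mulmC big_split /=; congr (op _ _); last by rewrite big_nat_rev.
rewrite -{1}[M]add0n big_addn -addnn addnK.
by apply: eq_bigr => i _; rewrite addnC.
Qed.

Lemma big_nat_fold_odd (g : nat -> T) M : \big[op/idx]_(0 <= k < M.*2.+1) g k =
  op (g M) (\big[op/idx]_(0 <= m < M) op (g (M + m.+1)%N) (g (M - m.+1)%N)).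
Proof.
rewrite (@big_cat_nat _ _ _ M) //=; last by rewrite -addnn; lia.
rewrite [LHS]Monoid.mulmC [X in op X _ = _]big_ltn; last by rewrite -addnn; lia.
rewrite -[LHS]Monoid.mulmA big_split /=; congr (op _ (op _ _)); last by rewrite big_nat_rev.
rewrite -{1}[M.+1]add0n big_addn -addnn -addnS addnK.
by apply: eq_bigr => i _; rewrite addnC addSnnS.
Qed.

End Fold.

Section QBinomial.
Variable A : comNzRingType.
Implicit Types s x y : A.

Fixpoint gaussbin s n k : A :=
  match n, k with
  | _, 0 => 1
  | 0, _.+1 => 0
  | n.+1, k.+1 => gaussbin s n k.+1 + s ^+ (n - k) * gaussbin s n k
  end.

Arguments gaussbin : simpl never.

Lemma gaussbin0 s n : gaussbin s n 0 = 1. Proof. by case: n. Qed.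

Lemma gaussbinS s n k :
  gaussbin s n.+1 k.+1 = gaussbin s n k.+1 + s ^+ (n - k) * gaussbin s n k.
Proof. by []. Qed.

Lemma gaussbin_small s n k : (n < k)%N -> gaussbin s n k = 0.
Proof.
elim: n k => [|n IHn] [|k] //; rewrite ltnS => ltnk.
by rewrite gaussbinS !IHn ?mulr0 ?addr0 // ltnW.
Qed.

(** After multiplication by the denominators the two Pascal terms become [1 - s ^+ (n - k)] and
    [s ^+ (n - k) * (1 - s ^+ k.+1)] times [qfac s s n], and these add up to [1 - s ^+ n.+1] times
    it. *)
Lemma gaussbin_qfac s n k : (k <= n)%N ->
  gaussbin s n k * (qfac s s k * qfac s s (n - k)) = qfac s s n.
Proof.
elim: n k => [|n IHn] [|k] //; first by rewrite gaussbin0 !qfac0 !mulr1.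
  by rewrite gaussbin0 qfac0 !mul1r subn0.
rewrite ltnS subSS => lekn; rewrite mulrDl [in RHS]qfacS -exprS.
have -> : s ^+ (n - k) * gaussbin s n k * (qfac s s k.+1 * qfac s s (n - k)) =
    s ^+ (n - k) * (1 - s ^+ k.+1) * qfac s s n.
  by rewrite -(IHn k lekn) qfacS -exprS; ring.
have -> : gaussbin s n k.+1 * (qfac s s k.+1 * qfac s s (n - k)) =
    (1 - s ^+ (n - k)) * qfac s s n.
  move: lekn; rewrite leq_eqVlt => /predU1P[->|ltkn].
    by rewrite gaussbin_small // subnn expr0 subrr !mul0r.
  rewrite -(IHn _ ltkn) -[in LHS](subnSK ltkn) [qfac s s (_ - _).+1]qfacS -exprS subnSK //.
  by ring.
rewrite -mulrDl mulrC; congr (_ * _).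
have -> : s ^+ n.+1 = s ^+ (n - k) * s ^+ k.+1 by rewrite -exprD addnS subnK.
by ring.
Qed.

Lemma bin2_mul2 k : ('C(k, 2) * 2 + k = k * k)%N.
Proof. by elim: k => // k IHk; rewrite binS bin1; nia. Qed.

(** Induction on [n]: in the last factor, [y] produces the first Pascal term and [x * s ^+ n] the
    second. The homogeneous form with [y] allows theta identities to be specialised without negative
    exponents. *)
Lemma qbinomial s x y n : \prod_(0 <= j < n) (y + x * s ^+ j) =
  \sum_(0 <= k < n.+1) gaussbin s n k * s ^+ 'C(k, 2) * x ^+ k * y ^+ (n - k).
Proof.
elim: n => [|n IHn].
  by rewrite big_geq // big_nat1 gaussbin0 !expr0 !mulr1.
rewrite big_nat_recr //= {}IHn [RHS]big_nat_recl //.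
under [X in _ = _ + X]eq_bigr => k _ do rewrite gaussbinS subSS !mulrDl.
rewrite big_split /= addrA mulrDr; congr (_ + _).
  rewrite [in LHS]big_nat_recl // !gaussbin0 !subn0 mulrDl; congr (_ + _).
    by rewrite -mulrA -exprSr.
  rewrite [in RHS]big_nat_recr //= gaussbin_small // !mul0r addr0 mulr_suml.
  apply: eq_big_nat => k /andP[_ ltk].
  by rewrite -mulrA -exprSr subnSK.
rewrite mulr_suml; apply: eq_big_nat => k /andP[_ ltk].
have -> : s ^+ n = s ^+ (n - k) * s ^+ k by rewrite -exprD subnK // -ltnS.
by rewrite binS bin1 exprD [x ^+ k.+1]exprS; ring.
Qed.

Lemma prod_expr_nat (t : A) (f : nat -> nat) N :
  \prod_(0 <= m < N) t ^+ f m = t ^+ (\sum_(0 <= m < N) f m).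
Proof. by elim/big_rec2: _ => // i x y _ ->; rewrite exprD. Qed.

(* The q-binomial theorem with base [t ^+ 2], [n = 2 N], [x = t] and
   [y = t ^+ (2 N)], after cancelling [t ^+ (3 N ^ 2)]. *)
Lemma theta3_fin (t : A) N : GRing.lreg t ->
  qfac (- t) (t ^+ 2) N ^+ 2 = gaussbin (t ^+ 2) N.*2 N +
  \sum_(0 <= m < N) t ^+ (m.+1 ^ 2)%N *
    (gaussbin (t ^+ 2) N.*2 (N + m.+1) + gaussbin (t ^+ 2) N.*2 (N - m.+1)).
Proof.
move=> treg; apply: (@lregX _ t (3 * N ^ 2)%N treg).
have := qbinomial (t ^+ 2) t (t ^+ N.*2) N.*2.
rewrite big_nat_fold big_nat_fold_odd /= => e.
(* The factors of indices [N + m] and [N - m.+1] are both powers of [t] times [1 + t ^+ m.*2.+1],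
   whence the square. *)
transitivity (\prod_(0 <= m < N) (t ^+ (4 * N - m.*2.+1) * (1 + t ^+ m.*2.+1) ^+ 2)).
  rewrite big_split /= prod_expr_nat prodrXl; congr (t ^+ _ * _ ^+ 2); last first.
    apply: eq_bigr => m _; rewrite mulNr opprK -exprM mul2n -exprS.
    by [].
  (* The exponents add up to [4 N ^ 2 - N ^ 2]; the additive form over partial ranges avoids
     truncated subtraction. *)
  suff h n : (n <= N)%N ->
      (\sum_(0 <= m < n) (4 * N - m.*2.+1) + n ^ 2 = 4 * N * n)%N.
    by have := h N (leqnn N); lia.
  elim: n => [|n IHn] ltn; first by rewrite big_geq // muln0.
  by rewrite big_nat_recr //=; have := IHn (ltnW ltn); nia.
transitivity (\prod_(0 <= m < N)
    ((t ^+ N.*2 + t * (t ^+ 2) ^+ (N + m)) *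
     (t ^+ N.*2 + t * (t ^+ 2) ^+ (N - m.+1)))).
  apply: eq_big_nat => m /andP[_ ltm].
  rewrite -!exprM -!exprS.
  have -> : (2 * (N + m)).+1 = (N.*2 + m.*2.+1)%N by lia.
  have -> : t ^+ N.*2 = t ^+ (2 * (N - m.+1)).+1 * t ^+ m.*2.+1.
    by rewrite -exprD; congr (t ^+ _); lia.
  have -> : (4 * N - m.*2.+1 = N.*2 + (2 * (N - m.+1)).+1)%N by lia.
  rewrite !exprD.
  have -> : t ^+ N.*2 = t ^+ (2 * (N - m.+1)).+1 * t ^+ m.*2.+1.
    by rewrite -exprD; congr (t ^+ _); lia.
  by ring.
rewrite {}e mulrDr mulr_sumr.
(* Completing the square: [k (k - 1) + k + 2 N (2 N - k) = 3 N ^ 2 + (N - k) ^ 2]. *)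
have expE k g : (k <= N.*2)%N ->
    g * (t ^+ 2) ^+ 'C(k, 2) * t ^+ k * t ^+ N.*2 ^+ (N.*2 - k) =
    t ^+ (3 * N ^ 2 + `|N%:Z - k%:Z| ^ 2) * g.
  move=> lek; rewrite -!exprM -!mulrA -!exprD mulrC.
  congr (t ^+ _ * _).
  have := bin2_mul2 k; nia.
congr (_ + _).
  by rewrite expE; [congr (t ^+ _ * _)|]; lia.
apply: eq_big_nat => m /andP[_ ltm].
rewrite !expE; [|lia..].
rewrite mulrA -exprD mulrDr.
by congr (t ^+ (_ + _ ^ 2) * _ + t ^+ (_ + _ ^ 2) * _); lia.
Qed.

(** The q-binomial theorem with base [t ^+ 2], [n = 2 N + 1], [x = 1] and [y = t ^+ (2 N)], after
    cancelling [t ^+ (3 N ^ 2 + N)]. The central factor [2 t ^+ (2 N)] has no partner and gives the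
    2 on the left. *)
Lemma theta2_fin (t : A) N : GRing.lreg t ->
  2 * qfac (- t ^+ 2) (t ^+ 2) N ^+ 2 =
  \sum_(0 <= m < N.+1) t ^+ (m * m.+1)%N *
    (gaussbin (t ^+ 2) N.*2.+1 (N.+1 + m) + gaussbin (t ^+ 2) N.*2.+1 (N.+1 - m.+1)).
Proof.
move=> treg; apply: (@lregX _ t (3 * N ^ 2 + N)%N treg).
have := qbinomial (t ^+ 2) 1 (t ^+ N.*2) N.*2.+1.
rewrite big_nat_fold_odd -doubleS big_nat_fold /= => e.
transitivity (2 * t ^+ N.*2 *
    \prod_(0 <= m < N) (t ^+ (4 * N - m.*2.+2) * (1 + t ^+ m.*2.+2) ^+ 2)).
  have -> : qfac (- t ^+ 2) (t ^+ 2) N = \prod_(0 <= m < N) (1 + t ^+ m.*2.+2).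
    by apply: eq_bigr => m _; rewrite mulNr opprK -exprM -exprD mul2n.
  rewrite big_split /= prod_expr_nat prodrXl.
  have -> : (3 * N ^ 2 + N = N.*2 + \sum_(0 <= m < N) (4 * N - m.*2.+2))%N.
    suff h n : (n <= N)%N ->
        (\sum_(0 <= m < n) (4 * N - m.*2.+2) + n ^ 2 + n = 4 * N * n)%N.
      by have := h N (leqnn N); lia.
    elim: n => [|n IHn] ltn; first by rewrite big_geq // muln0.
    by rewrite big_nat_recr //=; have := IHn (ltnW ltn); nia.
  by rewrite exprD; ring.
transitivity ((t ^+ N.*2 + 1 * (t ^+ 2) ^+ N) * \prod_(0 <= m < N)
    ((t ^+ N.*2 + 1 * (t ^+ 2) ^+ (N + m.+1)) *
     (t ^+ N.*2 + 1 * (t ^+ 2) ^+ (N - m.+1)))).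
  congr (_ * _); first by rewrite -exprM mul2n; ring.
  apply: eq_big_nat => m /andP[_ ltm].
  rewrite -!exprM.
  have -> : (2 * (N + m.+1) = N.*2 + m.*2.+2)%N by lia.
  have -> : (4 * N - m.*2.+2 = N.*2 + (2 * (N - m.+1)))%N by lia.
  rewrite ![t ^+ (N.*2 + _)]exprD.
  have -> : t ^+ N.*2 = t ^+ (2 * (N - m.+1)) * t ^+ m.*2.+2.
    by rewrite -exprD; congr (t ^+ _); lia.
  by ring.
rewrite {}e mulr_sumr.
(* The exponent left over is [(k - N) (k - N - 1)], written additively; it equals [m * m.+1] for
   both members of a pair. *)
have expE k g e : (k <= N.*2.+1)%N -> (k * k + N * N + N = e + k * N.*2.+1)%N ->
    g * (t ^+ 2) ^+ 'C(k, 2) * 1 ^+ k * t ^+ N.*2 ^+ (N.*2.+1 - k) =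
    t ^+ (3 * N ^ 2 + N + e) * g.
  move=> lek ke; rewrite expr1n mulr1 -!exprM -mulrA -exprD mulrC.
  by congr (t ^+ _ * _); have := bin2_mul2 k; nia.
apply: eq_big_nat => m /andP[_ ltm].
by rewrite !(expE _ _ (m * m.+1)%N) ?mulrDr ?mulrA -?exprD //; nia.
Qed.

End QBinomial.

(** * The theta functions phi and psi as infinite products *)

Section Theta.
Variable R : comNzRingType.
Implicit Types s t : fps R.

(** In the quotient of [qfac_gauss] type, [n], [k] and [n - k] all tend to infinity, so one of the
    two denominators cancels the numerator in the limit. *)
Lemma gaussbin_cvg s (n k : nat -> nat) m : vanish 1 s ->
  (forall N, m <= N -> [/\ k N <= n N, N <= k N + m & N <= n N - k N + m])%N ->
  fcvg (fun N => gaussbin s (n N) (k N)) (qpoch s s)^-1.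
Proof.
move=> vs nk; have c := qfac_cvg s vs.
have c1 : fcvg (qfac s s \o n) (qpoch s s).
  by apply: (fcvg_comp (m := m)) c => N /nk[]; lia.
have c2 : fcvg (qfac s s \o k) (qpoch s s).
  by apply: (fcvg_comp (m := m)) c => N /nk[].
have c3 : fcvg (qfac s s \o (fun N => n N - k N)%N) (qpoch s s).
  by apply: (fcvg_comp (m := m)) c => N /nk[].
have U N : qfac s s N \is a GRing.unit by apply: qfac_unit.
have Uoo : qpoch s s \is a GRing.unit by apply: qpoch_unit.
have := fcvgM c1 (fcvgV _ _ (fcvgM c2 c3)).
rewrite invrM // mulrA mulrV // mul1r => h.
apply: eq_fcvg_near (h _ _) => [N /nk[lek _ _]|N|]; last by rewrite unitrM Uoo.
  by rewrite /= -(gaussbin_qfac s lek) mulrK // unitrM !U.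
by rewrite unitrM !U.
Qed.

(** Product form of [phi (t)]: in [theta3_fin] both binomials of a pair tend to the inverse of [Q],
    which accounts for the 2. *)
Lemma theta3 t : vanish 1 t -> GRing.lreg t ->
  qpoch (- t) (t ^+ 2) ^+ 2 * qpoch (t ^+ 2) (t ^+ 2) =
  1 + 2 * fps_sum (fun m => t ^+ (m.+1 ^ 2)).
Proof.
move=> vt treg; have vt2 : vanish 1 (t ^+ 2) by apply/(vanish_le (n := 2))/vanishX.
have U : qpoch (t ^+ 2) (t ^+ 2) \is a GRing.unit by apply: qpoch_unit.
set Q := qpoch (t ^+ 2) _ in U *.
have vS m : vanish m (t ^+ (m.+1 ^ 2)).
  by apply: vanish_le (vanishX vt); nia.
suff -> : qpoch (- t) (t ^+ 2) ^+ 2 =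
    Q^-1 + fps_sum (fun m => 2 * Q^-1 * t ^+ (m.+1 ^ 2)).
  by rewrite fps_sumZ //; ring: (mulVr U).
have c := qfac_cvg (- t) vt2.
apply: fcvg_unique (fcvgM c c) _.
apply: eq_fcvg => [N|]; first by rewrite -expr2 theta3_fin.
apply: fcvgD.
  by apply: (gaussbin_cvg (m := 0)) => // N _; split; lia.
apply: (fcvg_Tannery (b := id)) => [//|N k|k].
  exact: vanishMr.
rewrite mulrC; apply: fcvgM; first exact: fcvg_cst.
rewrite mulr_natl mulr2n; apply: fcvgD.
  by apply: (gaussbin_cvg (m := k.+1)) => // N ?; split; lia.
by apply: (gaussbin_cvg (m := k.+1)) => // N ?; split; lia.
Qed.

(** Product form of [psi (t ^ 2)]. The 2 stays on both sides because it need not be cancellable in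
    [R]. *)
Lemma theta2 t : vanish 1 t -> GRing.lreg t ->
  2 * qpoch (- t ^+ 2) (t ^+ 2) ^+ 2 * qpoch (t ^+ 2) (t ^+ 2) =
  2 * fps_sum (fun m => t ^+ (m * m.+1)).
Proof.
move=> vt treg; have vt2 : vanish 1 (t ^+ 2) by apply/(vanish_le (n := 2))/vanishX.
have U : qpoch (t ^+ 2) (t ^+ 2) \is a GRing.unit by apply: qpoch_unit.
set Q := qpoch (t ^+ 2) _ in U *.
have vS m : vanish m (t ^+ (m * m.+1)).
  by apply: vanish_le (vanishX vt); nia.
suff -> : 2 * qpoch (- t ^+ 2) (t ^+ 2) ^+ 2 =
    fps_sum (fun m => 2 * Q^-1 * t ^+ (m * m.+1)).
  by rewrite fps_sumZ //; ring: (mulVr U).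
have c := qfac_cvg (- t ^+ 2) vt2.
apply: fcvg_unique (fcvgM (fcvg_cst 2) (fcvgM c c)) _.
apply: eq_fcvg => [N|]; first by rewrite -expr2 theta2_fin.
apply: (fcvg_Tannery (b := succn)) => [//|N k|k].
  exact: vanishMr.
rewrite mulrC; apply: fcvgM; first exact: fcvg_cst.
rewrite mulr_natl mulr2n; apply: fcvgD.
  by apply: (gaussbin_cvg (m := k.+1)) => // N ?; split; lia.
by apply: (gaussbin_cvg (m := k.+1)) => // N ?; split; lia.
Qed.

(** [phi (t) = phi (t ^ 4) + 2 t psi (t ^ 8)]: even squares are 4 times a square, and odd squares
    are [4 m (m + 1) + 1]. *)
Lemma theta3_dissection t : vanish 1 t -> GRing.lreg t ->
  qpoch (- t) (t ^+ 2) ^+ 2 * qpoch (t ^+ 2) (t ^+ 2) =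
  qpoch (- t ^+ 4) (t ^+ 8) ^+ 2 * qpoch (t ^+ 8) (t ^+ 8) +
  t * (2 * qpoch (- t ^+ 8) (t ^+ 8) ^+ 2 * qpoch (t ^+ 8) (t ^+ 8)).
Proof.
move=> vt treg; have vt4 : vanish 1 (t ^+ 4) by apply/(vanish_le (n := 4))/vanishX.
have e8 : (t ^+ 4) ^+ 2 = t ^+ 8 by rewrite -exprM.
have E3 := theta3 vt4 (@lregX _ t 4 treg); have E2 := theta2 vt4 (@lregX _ t 4 treg).
rewrite e8 in E3 E2; rewrite [LHS](theta3 vt treg) [X in _ = X + _]E3.
rewrite [X in _ = _ + _ * X]E2.
(* The index [m] stands for the square of [m.+1], so the even indices carry the odd squares. *)
rewrite fps_sum_even_odd => [|m]; last by apply: vanish_le (vanishX vt); nia.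
have -> : fps_sum (fun n => t ^+ (n.*2.+1 ^ 2)) =
    t * fps_sum (fun m => t ^+ 4 ^+ (m * m.+1)).
  rewrite -fps_sumZ => [|m]; last by apply: vanish_le (vanishX vt4); nia.
  by congr fps_sum; apply/funext => m; rewrite -exprM -exprS; congr (t ^+ _); lia.
have -> : fps_sum (fun n => t ^+ (n.*2.+2 ^ 2)) =
    fps_sum (fun m => t ^+ 4 ^+ (m.+1 ^ 2)).
  by congr fps_sum; apply/funext => m; rewrite -exprM; congr (t ^+ _); lia.
by rewrite mulrDr [2 * (t * _)]mulrCA addrCA addrC.
Qed.

End Theta.

(** * Partial fractions of the finite product *)

Lemma prod_nat_neq (A : comNzRingType) (f : nat -> A) k r :
  \prod_(0 <= j < k + r.+1 | j != k) f j =
  \prod_(0 <= j < k) f j * \prod_(0 <= i < r) f (k.+1 + i)%N.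
Proof.
rewrite (@big_cat_nat _ _ _ k) ?leq_addr //=; congr (_ * _).
  rewrite big_nat_cond [RHS]big_nat_cond; apply: eq_bigl => j.
  by case: ltngtP; rewrite ?andbF // andbT.
rewrite big_ltn_cond ?eqxx /=; last by lia.
rewrite -{1}[k.+1]add0n big_addn addnS subSS addKn.
rewrite big_mkcond /=; apply: eq_bigr => i _.
by rewrite addnC ifT //; lia.
Qed.

Section PfTerms.
Variable A : comUnitRingType.
Implicit Types t z : A.

Definition pfden t z k := (1 - z * t ^+ k) * (1 - z^-1 * t ^+ k).

Definition pfnum t z N :=
  qfac (- (z * t ^+ 2)) (t ^+ 2) N * qfac (- (t ^+ 2 / z)) (t ^+ 2) N.

End PfTerms.

Section PartialFractions.
Variable K : fieldType.

(** The difference of [p] and its interpolant has size at most [n] and vanishes at [n] distinct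
    nodes, hence is zero. *)
Lemma lagrange_interpolation (x : nat -> K) n (p : {poly K}) (y : K) :
  injective x -> (size p <= n)%N ->
  p.[y] = \sum_(0 <= i < n) p.[x i] *
    \prod_(0 <= j < n | j != i) ((y - x j) / (x i - x j)).
Proof.
move=> xI lep.
pose l i : {poly K} := \prod_(0 <= j < n | j != i) ((x i - x j)^-1 *: ('X - (x j)%:P)).
have lE i u : (l i).[u] = \prod_(0 <= j < n | j != i) ((u - x j) / (x i - x j)).
  by rewrite horner_prod; apply: eq_bigr => j _; rewrite !hornerE mulrC.
suff pE : p = \sum_(0 <= i < n) p.[x i] *: l i.
  rewrite [in LHS]pE.
  by rewrite horner_sum; apply: eq_bigr => i _; rewrite hornerZ lE.
have size_l i : (i < n)%N -> (size (l i) <= n)%N.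
  move=> ltin.
  have szp (s : seq nat) : (size (\prod_(j <- s)
      ((x i - x j)^-1 *: ('X - (x j)%:P)))%R <= (size s).+1)%N.
    elim: s => [|j s IHs]; first by rewrite big_nil size_poly1.
    rewrite big_cons (leq_trans (size_polyMleq _ _)) //= -subn1 leq_subLR addnC.
    rewrite (leq_trans (leq_add IHs (size_scale_leq _ _))) // size_XsubC addSnnS.
    by rewrite addnC; exact: leqnn.
  have -> : l i = \prod_(j <- [seq j <- iota 0 n | j != i])
      ((x i - x j)^-1 *: ('X - (x j)%:P)) by rewrite big_filter /l /index_iota subn0.
  rewrite (leq_trans (szp _)) // size_filter.
  have := count_predC (pred1 i) (iota 0 n).
  by rewrite count_uniq_mem ?iota_uniq // mem_iota ltin size_iota add1n => ->.
apply/eqP; rewrite -subr_eq0; apply/eqP.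
apply: (@roots_geq_poly_eq0 _ _ [seq x i | i <- iota 0 n]).
- apply/allP => _ /mapP[k + ->]; rewrite mem_iota /= add0n => ltkn.
  rewrite rootE hornerD hornerN horner_sum big_mkord (bigD1 (Ordinal ltkn)) //=.
  rewrite hornerZ lE big1 ?mulr1 => [|j neq_jk]; last first.
    by rewrite divff // subr_eq0 (inj_eq xI) eq_sym.
  rewrite opprD addNKr oppr_eq0 big1 // => i neq_ik.
  rewrite hornerZ lE big_mkord (bigD1 (Ordinal ltkn)) /= ?subrr ?mul0r ?mulr0 //.
  by rewrite eq_sym.
- by rewrite map_inj_uniq ?iota_uniq.
rewrite size_map size_iota (leq_trans (size_polyD _ _)) // geq_max lep size_polyN.
rewrite big_mkord; apply: (big_ind (fun f : {poly K} => size f <= n)%N).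
- by rewrite size_poly0.
- by move=> f g szf szg; rewrite (leq_trans (size_polyD _ _)) // geq_max szf.
by move=> i _; rewrite (leq_trans (size_scale_leq _ _)) // size_l.
Qed.

Variable t : K.
Hypothesis t_free : forall k, (0 < k)%N -> t ^+ k != 1.
Hypothesis t_neq0 : t != 0.

Lemma qfac_neq0 n : qfac t t n != 0.
Proof.
elim: n => [|n IHn]; first by rewrite qfac0 oner_neq0.
by rewrite qfacS mulf_neq0 // subr_eq0 eq_sym -exprS t_free.
Qed.

Lemma expr_opp1_neq k : (0 < k)%N -> 1 + t ^+ k != 0.
Proof.
move=> k0; apply: contraNneq (t_free (k := k.*2) _) => [e|]; last by lia.
rewrite -muln2 exprM -subr_eq0 subr_sqr_1 mulrC addrC e mul0r //.
Qed.

(** Each factor is [1 - t ^ (- i)] with [1 <= i <= k]; extracting [- t ^ (- i)] from all of them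
    gives the sign and the exponent [1 + ... + k]. *)
Lemma pfden_partial k : (\prod_(0 <= j < k) (1 - t ^+ j / t ^+ k)) * t ^+ 'C(k.+1, 2) =
  (-1) ^+ k * qfac t t k.
Proof.
elim: k => [|k IHk]; first by rewrite big_geq // qfac0 !mulr1.
rewrite big_nat_recl //.
have -> : \prod_(0 <= i < k) (1 - t ^+ i.+1 / t ^+ k.+1) =
    \prod_(0 <= i < k) (1 - t ^+ i / t ^+ k).
  by apply: eq_bigr => i _; rewrite !exprS -mulf_div divff // mul1r.
rewrite binS bin1 exprD [t ^+ 'C(_, _) * _]mulrC mulrACA {}IHk qfacS -exprS [(-1) ^+ k.+1]exprS expr0.
have : t ^+ k.+1 != 0 by rewrite expf_neq0.
by move: (t ^+ k.+1) => u u0; field.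
Qed.

(** The middle product starts with [1 - t ^+ k.+1] where the long factorial ends with
    [1 - t ^+ k.+1.*2]; the factor [1 + t ^+ k.+1] repairs this. *)
Lemma qfac_double k : qfac t t k.+1 * (\prod_(0 <= j < k.+1) (1 - t ^+ k.+1 * t ^+ j)) *
   (1 + t ^+ k.+1) = qfac t t k.+1.*2.
Proof.
have -> : (k.+1.*2 = (k + k.+1).+1)%N by lia.
rewrite !qfacS qfac_add -!exprS.
rewrite -[\prod_(_ <= _ < _) _]/(qfac (t ^+ k.+1) t k.+1).
have -> : t ^+ (k + k.+1).+1 = t ^+ k.+1 * t ^+ k.+1 by rewrite -exprD.
by ring.
Qed.

(** The denominator of the Lagrange coefficient at the node [z = t ^+ k]. The node [k = 0] is
    treated apart: there the factor [1 + t ^+ k] would be a spurious 2. *)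
Lemma pfden_eval k r : (0 < k)%N ->
  (\prod_(0 <= j < k + r.+1 | j != k) pfden t (t ^+ k) j) *
    ((1 + t ^+ k) * t ^+ 'C(k.+1, 2)) =
  (-1) ^+ k * (qfac t t (k.*2 + r) * qfac t t r).
Proof.
move=> k0; rewrite prod_nat_neq !big_split /=.
have -> : \prod_(0 <= i < r) (1 - t ^+ k * t ^+ (k.+1 + i)) = qfac (t * t ^+ k.*2) t r.
  by apply: eq_bigr => i _; rewrite -!exprS -!exprD; congr (1 - t ^+ _); lia.
have -> : \prod_(0 <= i < r) (1 - (t ^+ k)^-1 * t ^+ (k.+1 + i)) = qfac t t r.
  apply: eq_bigr => i _; rewrite exprD exprSr !mulrA mulVf ?mul1r //.
  by rewrite expf_neq0.
have d := qfac_double k.-1; rewrite prednK // in d.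
have p : (\prod_(0 <= j < k) (1 - (t ^+ k)^-1 * t ^+ j)) * t ^+ 'C(k.+1, 2) =
    (-1) ^+ k * qfac t t k.
  by rewrite -pfden_partial; congr (_ * _); apply: eq_bigr => j _; rewrite mulrC.
rewrite qfac_add -d.
rewrite [RHS](_ : _ = ((-1) ^+ k * qfac t t k) *
  (\prod_(0 <= j < k) (1 - t ^+ k * t ^+ j) * (1 + t ^+ k) *
   qfac (t * t ^+ k.*2) t r * qfac t t r)); last by ring.
by rewrite -p; ring.
Qed.

(** The factors are [1 + t ^ (- 2 i)] for [0 <= i <= m]; [i = 0] gives the 2, and clearing the
    others costs [t ^ (2 + 4 + ... + 2 m)]. *)
Lemma pfnum_partial_even m :
  qfac (- (t ^+ 2 / t ^+ m.+1.*2)) (t ^+ 2) m.+1 * t ^+ (m * m.+1) =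
  2 * qfac (- t ^+ 2) (t ^+ 2) m.
Proof.
elim: m => [|m IHm].
  rewrite qfacS !qfac0 mul0n !expr0 -[1.*2]/2%N divff ?expf_neq0 //; ring.
rewrite [in LHS]/qfac big_nat_recl // [in RHS]qfacS mulrA -{}IHm.
have -> : \prod_(0 <= i < m.+1) (1 - - (t ^+ 2 / t ^+ m.+2.*2) * t ^+ 2 ^+ i.+1) =
    qfac (- (t ^+ 2 / t ^+ m.+1.*2)) (t ^+ 2) m.+1.
  apply: eq_bigr => i _; rewrite [m.+2.*2]doubleS !mulNr -[m.+1.*2.+2]addn2 exprD.
  rewrite [t ^+ 2 ^+ i.+1]exprS; have := expf_neq0 2 t_neq0.
  by have := expf_neq0 m.+1.*2 t_neq0; move: (t ^+ 2) (t ^+ m.+1.*2) => u v v0 u0; field; rewrite ?u0 ?v0.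
have -> : (m.+1 * m.+2 = m * m.+1 + m.+1.*2)%N by lia.
rewrite exprD [m.+2.*2]doubleS -[m.+1.*2.+2]addn2 exprD expr0.
have -> : - t ^+ 2 * t ^+ 2 ^+ m = - t ^+ m.+1.*2.
  by rewrite mulNr -exprS -exprM; congr (- t ^+ _); lia.
have := expf_neq0 2 t_neq0; have := expf_neq0 m.+1.*2 t_neq0.
by move: (t ^+ 2) (t ^+ m.+1.*2) (t ^+ (m * m.+1)) (qfac _ _ _) => u v a b v0 u0; field; rewrite ?u0 ?v0.
Qed.

(** Here the exponents are [- 1, - 3, ..., - (2 m - 1)], with sum [- m ^ 2]. *)
Lemma pfnum_partial_odd m :
  qfac (- (t ^+ 2 / t ^+ m.*2.+1)) (t ^+ 2) m * t ^+ (m ^ 2) =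
  qfac (- t) (t ^+ 2) m.
Proof.
elim: m => [|m IHm]; first by rewrite !qfac0 mulr1.
rewrite [in LHS]/qfac big_nat_recl // [in RHS]qfacS -{}IHm.
have -> : \prod_(0 <= i < m) (1 - - (t ^+ 2 / t ^+ m.+1.*2.+1) * t ^+ 2 ^+ i.+1) =
    qfac (- (t ^+ 2 / t ^+ m.*2.+1)) (t ^+ 2) m.
  apply: eq_bigr => i _; rewrite doubleS !mulNr -[m.*2.+3]addn2 exprD.
  rewrite [t ^+ 2 ^+ i.+1]exprS; have := expf_neq0 2 t_neq0.
  by have := expf_neq0 m.*2.+1 t_neq0; move: (t ^+ 2) (t ^+ m.*2.+1) => u v v0 u0; field; rewrite ?u0 ?v0.
have -> : (m.+1 ^ 2 = m ^ 2 + m.*2.+1)%N by lia.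
rewrite exprD doubleS -[m.*2.+3]addn2 exprD expr0.
have -> : - t * t ^+ 2 ^+ m = - t ^+ m.*2.+1.
  by rewrite mulNr -exprM -exprS; congr (- t ^+ _); lia.
have := expf_neq0 2 t_neq0; have := expf_neq0 m.*2.+1 t_neq0.
by move: (t ^+ 2) (t ^+ m.*2.+1) (t ^+ (m ^ 2)) (qfac _ _ _) => u v a b v0 u0; field; rewrite ?u0 ?v0.
Qed.

(** The numerator at an even node. The factor [1 + t ^+ k] is kept on the left, here and at odd
    nodes, so as to cancel against the one in [pfden_eval]. *)
Lemma pfnum_even m r :
  pfnum t (t ^+ m.+1.*2) (m.+1 + r) * ((1 + t ^+ m.+1.*2) * t ^+ (m * m.+1)) =
  2 * (qfac (- t ^+ 2) (t ^+ 2) (m.+1.*2 + r) * qfac (- t ^+ 2) (t ^+ 2) r).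
Proof.
rewrite /pfnum [X in _ * X * _]qfac_add.
have -> : - (t ^+ 2 / t ^+ m.+1.*2) * t ^+ 2 ^+ m.+1 = - t ^+ 2.
  by rewrite mulNr -exprM mul2n divfK // expf_neq0.
have -> : - (t ^+ m.+1.*2 * t ^+ 2) = - t ^+ 2 * t ^+ 2 ^+ m.+1.
  by rewrite -exprM mul2n mulrC mulNr.
rewrite -addnn -addnA [qfac (- t ^+ 2) _ (m.+1 + (m.+1 + r))]qfac_add addnn.
have := pfnum_partial_even m; have -> : 1 + t ^+ m.+1.*2 = 1 - - t ^+ 2 * t ^+ 2 ^+ m.
  by rewrite mulNr opprK -exprS -exprM mul2n.
move=> e; rewrite [qfac _ _ m.+1 in RHS]qfacS.
by ring: e.
Qed.

Lemma pfnum_odd m r :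
  pfnum t (t ^+ m.*2.+1) (m + r) * ((1 + t ^+ m.*2.+1) * t ^+ (m ^ 2)) =
  qfac (- t) (t ^+ 2) (m.*2.+1 + r) * qfac (- t) (t ^+ 2) r.
Proof.
rewrite /pfnum [X in _ * X * _]qfac_add.
have -> : - (t ^+ 2 / t ^+ m.*2.+1) * t ^+ 2 ^+ m = - t.
  rewrite mulNr -exprM mul2n mulrAC -exprD; congr (- _).
  by apply: (canLR (mulfK _)); [rewrite expf_neq0 | rewrite -exprS].
have -> : - (t ^+ m.*2.+1 * t ^+ 2) = - t * t ^+ 2 ^+ m.+1.
  by rewrite mulNr -exprM -exprD -exprS; congr (- t ^+ _); lia.
have -> : (m.*2.+1 + r = m.+1 + (m + r))%N by lia.
rewrite [qfac (- t) _ (m.+1 + (m + r))]qfac_add.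
have := pfnum_partial_odd m; have -> : 1 + t ^+ m.*2.+1 = 1 - - t * t ^+ 2 ^+ m.
  by rewrite mulNr opprK -exprM -exprS mul2n.
move=> e; rewrite [qfac _ _ m.+1 in RHS]qfacS.
by ring: e.
Qed.

Lemma expr_inj : injective (fun k => t ^+ k).
Proof.
have h j k : (j <= k)%N -> t ^+ j = t ^+ k -> j = k.
  move=> lejk /eqP; rewrite -(subnKC lejk) exprD -[X in X == _]mulr1.
  rewrite (inj_eq (mulfI (expf_neq0 j t_neq0))) eq_sym.
  by case: (posnP (k - j)) => [->|/t_free/negPf -> //]; rewrite addn0.
move=> j k /= e; have [lejk|/ltnW lekj] := leqP j k; first exact: h.
by apply/esym/h.
Qed.

(** [u + 1 / u = v + 1 / v] forces [u = v] or [u v = 1]; the latter gives [t ^+ (j + k) = 1], hence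
    [j = k = 0]. *)
Lemma pfnode_inj : injective (fun k => t ^+ k + (t ^+ k)^-1).
Proof.
move=> j k /= e; have hj := expf_neq0 j t_neq0; have hk := expf_neq0 k t_neq0.
have : (t ^+ j - t ^+ k) * (1 - (t ^+ j * t ^+ k)^-1) == 0.
  have -> : (t ^+ j - t ^+ k) * (1 - (t ^+ j * t ^+ k)^-1) =
      (t ^+ j + (t ^+ j)^-1) - (t ^+ k + (t ^+ k)^-1).
    by move: (t ^+ j) (t ^+ k) hj hk => a b a0 b0; field; rewrite ?a0 ?b0.
  by rewrite e subrr.
rewrite mulf_eq0 !subr_eq0 => /orP[/eqP/expr_inj //|].
rewrite eq_sym invr_eq1 -exprD => e1.
have : (j + k = 0)%N by case: (posnP (j + k)) => // /t_free; rewrite e1.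
by lia.
Qed.

(** As a polynomial in [y = z + 1 / z] the numerator has degree at most [N], so its values at the
    [2 N + 1] nodes [t ^+ k + (t ^+ k)^-1] determine it. *)
Lemma pfnum_lagrange z N : z != 0 ->
  pfnum t z N = \sum_(0 <= k < N.*2.+1) pfnum t (t ^+ k) N *
    \prod_(0 <= j < N.*2.+1 | j != k) (pfden t z j / pfden t (t ^+ k) j).
Proof.
move=> z0.
(* With [b = t ^+ j.*2.+2], [(1 + z b) (1 + b / z) = 1 + b ^ 2 + b y]. *)
pose p n : {poly K} := \prod_(0 <= j < n)
  ((1 + (t ^+ j.*2.+2) ^+ 2)%:P + t ^+ j.*2.+2 *: 'X).
have szp n : (size (p n) <= n.+1)%N.
  rewrite /p; elim: n => [|n IHn]; first by rewrite big_geq ?size_poly1.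
  rewrite big_nat_recr //= (leq_trans (size_polyMleq _ _)) //.
  set f := (X in size X) in IHn *; set g := (X in (_ + size X)%N).
  suff : (size g <= 2)%N by move: IHn; lia.
  rewrite (leq_trans (size_polyD _ _)) // geq_max (leq_trans (size_polyC_leq1 _)) //.
  by rewrite (leq_trans (size_scale_leq _ _)) // size_polyX.
have pE u : u != 0 -> (p N).[u + u^-1] = pfnum t u N.
  move=> u0; rewrite horner_prod /pfnum /qfac -big_split /=.
  apply: eq_bigr => j _; transitivity
    (1 + (t ^+ j.*2.+2) ^+ 2 + t ^+ j.*2.+2 * (u + u^-1)); first by rewrite !hornerE.
  have -> : t ^+ j.*2.+2 = t ^+ 2 * t ^+ 2 ^+ j.
    by rewrite -exprS -exprM; congr (t ^+ _); lia.
  by move: (t ^+ 2) => b; move: (b ^+ j) => a; field.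
have leN : (size (p N) <= N.*2.+1)%N by apply: leq_trans (szp N) _; lia.
rewrite -pE // (lagrange_interpolation _ pfnode_inj leN).
apply: eq_bigr => k _; rewrite pE ?expf_neq0 //; congr (_ * _).
(* Each [pfden] is a multiple of [y] minus the [j]-th node, by a constant that cancels in the
   ratio. *)
have dE u j : u != 0 ->
    pfden t u j = - t ^+ j * (u + u^-1 - (t ^+ j + (t ^+ j)^-1)).
  move=> u0; rewrite /pfden; have := expf_neq0 j t_neq0.
  by move: (t ^+ j) => a a0; field; rewrite ?u0 ?a0.
apply: eq_bigr => j _; rewrite !dE ?expf_neq0 // -mulf_div divff ?mul1r //.
by rewrite oppr_eq0 expf_neq0.
Qed.

(** Division of a numerator value [a] by a denominator value [b]: [u] is the common [1 + t ^+ k],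
    [v] and [v * w] are the powers of [t] cleared in each, and [s] is the sign. *)
Lemma coef_ratio (a b u v w B E s : K) : a * (u * v) = B ->
  b * (u * (v * w)) = s * E -> s ^+ 2 = 1 -> u != 0 -> v != 0 -> w != 0 -> E != 0 ->
  a / b = s * w * B / E.
Proof.
move=> <- e s2 u0 v0 w0 E0.
have s0 : s != 0 by apply: contra_eq_neq s2 => ->; rewrite expr0n eq_sym oner_neq0.
have -> : b = s * E / (u * (v * w)) by rewrite -e mulfK // !mulf_neq0.
have -> : s * w * (a * (u * v)) / E = s ^+ 2 * (w * (a * (u * v)) / (s * E)).
  by field; rewrite ?s0 ?E0.
by rewrite s2; field; rewrite ?s0 ?E0 ?u0 ?v0 ?w0.
Qed.

(** The exponent is ['C(k.+1, 2)] from the denominator less [m ^ 2] from the numerator: exactly the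
    exponent in the odd-indexed rank terms. *)
Lemma coef_odd m r : let k := m.*2.+1 in
  pfnum t (t ^+ k) (m + r.+1) /
    \prod_(0 <= j < (m + r.+1).*2.+1 | j != k) pfden t (t ^+ k) j =
  - t ^+ (m ^ 2 + 3 * m + 1) *
    (qfac (- t) (t ^+ 2) (m.*2.+1 + r.+1) * qfac (- t) (t ^+ 2) r.+1) /
    (qfac t t ((m + r.+1).*2 + k) * qfac t t ((m + r.+1).*2 - k)).
Proof.
move=> k; have := pfnum_odd m r.+1; have := @pfden_eval k r.*2.+1 isT.
have -> : (k + r.*2.+2 = (m + r.+1).*2.+1)%N by lia.
have -> : (k.*2 + r.*2.+1 = (m + r.+1).*2 + k)%N by lia.
have -> : (r.*2.+1 = (m + r.+1).*2 - k)%N by lia.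
have -> : ('C(k.+1, 2) = m ^ 2 + (m ^ 2 + 3 * m + 1))%N.
  by have := bin2_mul2 k.+1; lia.
rewrite exprD => ed en; rewrite (coef_ratio en ed) ?expf_neq0 ?expr_opp1_neq //.
- by rewrite -signr_odd /= odd_double expr1 mulN1r.
- by rewrite sqrr_sign.
by rewrite mulf_neq0 ?qfac_neq0.
Qed.

Lemma coef_even m r : let k := m.+1.*2 in
  pfnum t (t ^+ k) (m.+1 + r) /
    \prod_(0 <= j < (m.+1 + r).*2.+1 | j != k) pfden t (t ^+ k) j =
  t ^+ (m.+1 ^ 2 + 2 * m.+1) *
    (2 * (qfac (- t ^+ 2) (t ^+ 2) (m.+1.*2 + r) * qfac (- t ^+ 2) (t ^+ 2) r)) /
    (qfac t t ((m.+1 + r).*2 + k) * qfac t t ((m.+1 + r).*2 - k)).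
Proof.
move=> k; have := pfnum_even m r; have := @pfden_eval k r.*2 isT.
have -> : (k + r.*2.+1 = (m.+1 + r).*2.+1)%N by lia.
have -> : (k.*2 + r.*2 = (m.+1 + r).*2 + k)%N by lia.
have -> : (r.*2 = (m.+1 + r).*2 - k)%N by lia.
have -> : ('C(k.+1, 2) = m * m.+1 + (m.+1 ^ 2 + 2 * m.+1))%N.
  by have := bin2_mul2 k.+1; lia.
rewrite exprD => ed en; rewrite (coef_ratio en ed) ?expf_neq0 ?expr_opp1_neq //.
- by rewrite -signr_odd odd_double expr0 mul1r.
- by rewrite sqrr_sign.
by rewrite mulf_neq0 ?qfac_neq0.
Qed.

(** Divide [pfnum_lagrange] by the product of [pfden t z j] over [1 <= j <= 2 N]. The node 0 gives
    the term free of [z]; the others are grouped as [2 m + 1] and [2 m + 2]. *)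
Lemma partial_fractions z N : z != 0 -> (forall k, (0 < k)%N -> pfden t z k != 0) ->
  pfnum t z N / (qfac (z * t) t N.*2 * qfac (t / z) t N.*2) =
  qfac (- t ^+ 2) (t ^+ 2) N ^+ 2 / qfac t t N.*2 ^+ 2 +
  \sum_(0 <= m < N)
    (- t ^+ (m ^ 2 + 3 * m + 1) *
       (qfac (- t) (t ^+ 2) (N + m.+1) * qfac (- t) (t ^+ 2) (N - m)) /
       (qfac t t (N.*2 + m.*2.+1) * qfac t t (N.*2 - m.*2.+1)) *
       (pfden t z 0 / pfden t z m.*2.+1) +
     t ^+ (m.+1 ^ 2 + 2 * m.+1) *
       (2 * (qfac (- t ^+ 2) (t ^+ 2) (N + m.+1) * qfac (- t ^+ 2) (t ^+ 2) (N - m.+1))) /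
       (qfac t t (N.*2 + m.*2.+2) * qfac t t (N.*2 - m.*2.+2)) *
       (pfden t z 0 / pfden t z m.*2.+2)).
Proof.
move=> z0 dz.
have WE : qfac (z * t) t N.*2 * qfac (t / z) t N.*2 = \prod_(1 <= j < N.*2.+1) pfden t z j.
  rewrite big_add1 /= -big_split /=; apply: eq_bigr => j _.
  by rewrite /pfden exprS [t / z]mulrC !mulrA.
rewrite {}WE; set W := \prod_(1 <= j < _) _.
have W0 : W != 0.
  rewrite /W big_nat_cond prodf_seq_neq0; apply/allP => j _; apply/implyP.
  by move=> /andP[/andP[j0 _] _]; apply: dz.
(* Compared with [W], the Lagrange product contains the factor of index 0 and lacks that of index
   [k]. *)
have dropk k : (0 < k <= N.*2)%N ->
    \prod_(0 <= j < N.*2.+1 | j != k) pfden t z j = W * (pfden t z 0 / pfden t z k).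
  case/andP=> k0 lek; rewrite big_ltn_cond //= eq_sym -lt0n k0.
  rewrite /W (bigD1_seq k) ?iota_uniq ?mem_index_iota ?k0 //=.
  by move: (dz k k0) => d0; field.
rewrite pfnum_lagrange // mulr_suml big_nat_recl //; congr (_ + _).
  have drop0 (f : nat -> K) :
      \prod_(0 <= j < N.*2.+1 | j != 0%N) f j = \prod_(1 <= j < N.*2.+1) f j.
    rewrite big_ltn_cond // eqxx big_nat_cond [RHS]big_nat_cond; apply: eq_bigl => j.
    by rewrite andbT -lt0n; case: (0 < j)%N; rewrite ?andbF ?andbT.
  rewrite prodf_div !drop0 -/W expr0 /pfnum mul1r divr1 -expr2.
  have -> : \prod_(1 <= j < N.*2.+1) pfden t 1 j = qfac t t N.*2 ^+ 2.
    rewrite expr2 -big_split /= big_add1; apply: eq_bigr => j _.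
    by rewrite /pfden invr1 !mul1r exprS.
  by field; rewrite ?W0 ?qfac_neq0.
transitivity (\sum_(0 <= k < N.*2) pfnum t (t ^+ k.+1) N /
   \prod_(0 <= j < N.*2.+1 | j != k.+1) pfden t (t ^+ k.+1) j *
   (pfden t z 0 / pfden t z k.+1)).
  apply: eq_big_nat => k /andP[_ ltk]; rewrite prodf_div dropk ?ltk //.
  by ring: (mulfV W0).
have pairs (g : nat -> K) n :
    \sum_(0 <= k < n.*2) g k = \sum_(0 <= m < n) (g m.*2 + g m.*2.+1).
  elim: n => [|n IHn]; first by rewrite !big_geq.
  by rewrite doubleS !big_nat_recr //= IHn addrA.
rewrite pairs; apply: eq_big_nat => m /andP[_ ltm]; congr (_ * _ + _ * _).
  have [r ->] : exists r, N = (m + r.+1)%N by exists (N - m.+1)%N; lia.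
  rewrite coef_odd.
  have -> : (m + r.+1 + m.+1 = m.*2.+1 + r.+1)%N by lia.
  by rewrite addKn.
have [r ->] : exists r, N = (m.+1 + r)%N by exists (N - m.+1)%N; lia.
rewrite -doubleS coef_even.
have -> : (m.+1 + r + m.+1 = m.+1.*2 + r)%N by lia.
by rewrite addKn.
Qed.

End PartialFractions.

(** * Partial fractions over an integral domain *)

Section IntegralDomain.
Variable A : idomainType.
Variables t z : A.
Hypotheses (t_neq0 : t != 0) (zU : z \is a GRing.unit).
Hypothesis tU : forall k, (0 < k)%N -> 1 - t ^+ k \is a GRing.unit.
Hypothesis dU : forall k, (0 < k)%N -> pfden t z k \is a GRing.unit.

Lemma pf_qfac_unit n : qfac t t n \is a GRing.unit.
Proof.
by rewrite /qfac rpred_prod // => i _; rewrite -exprS tU.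
Qed.

Lemma pf_den_prod n :
  qfac (z * t) t n * qfac (t / z) t n = \prod_(0 <= j < n) pfden t z j.+1.
Proof.
rewrite -big_split /=; apply: eq_bigr => j _.
by rewrite /pfden exprS [t / z]mulrC !mulrA.
Qed.

Lemma pf_den_unit n : qfac (z * t) t n * qfac (t / z) t n \is a GRing.unit.
Proof. by rewrite pf_den_prod rpred_prod // => i _; apply: dU. Qed.

(** The identity is checked in the field of fractions; all denominators are units of [A], so their
    inverses are preserved by the embedding. *)
Lemma partial_fractions_domain N :
  pfnum t z N / (qfac (z * t) t N.*2 * qfac (t / z) t N.*2) =
  qfac (- t ^+ 2) (t ^+ 2) N ^+ 2 / qfac t t N.*2 ^+ 2 +
  \sum_(0 <= m < N)
    (- t ^+ (m ^ 2 + 3 * m + 1) *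
       (qfac (- t) (t ^+ 2) (N + m.+1) * qfac (- t) (t ^+ 2) (N - m)) /
       (qfac t t (N.*2 + m.*2.+1) * qfac t t (N.*2 - m.*2.+1)) *
       (pfden t z 0 / pfden t z m.*2.+1) +
     t ^+ (m.+1 ^ 2 + 2 * m.+1) *
       (2 * (qfac (- t ^+ 2) (t ^+ 2) (N + m.+1) * qfac (- t ^+ 2) (t ^+ 2) (N - m.+1))) /
       (qfac t t (N.*2 + m.*2.+2) * qfac t t (N.*2 - m.*2.+2)) *
       (pfden t z 0 / pfden t z m.*2.+2)).
Proof.
pose phi : {rmorphism A -> {fraction A}} := @FracField.tofrac A.
have phi_inj f g : phi f = phi g -> f = g by move/eqP; rewrite tofrac_eq => /eqP.
have phi_neq0 f : (phi f == 0) = (f == 0) by rewrite tofrac_eq0.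
move: phi phi_inj phi_neq0 => phi phi_inj phi_neq0.
have phiQ w s n : phi (qfac w s n) = qfac (phi w) (phi s) n by rewrite rmorph_qfac.
have phiV f : f \is a GRing.unit -> phi f^-1 = (phi f)^-1 by apply: rmorphV.
have phiD k : phi (pfden t z k) = pfden (phi t) (phi z) k.
  by rewrite /pfden rmorphM !rmorphB !rmorphM !rmorph1 phiV // !rmorphXn.
have t_free k : (0 < k)%N -> phi t ^+ k != 1.
  move=> k0; rewrite -rmorphXn -subr_eq0 -(rmorph1 phi) -rmorphB phi_neq0.
  rewrite -oppr_eq0 opprB.
  by apply: contraTneq (tU k0) => ->; rewrite unitr0.
have dz k : (0 < k)%N -> pfden (phi t) (phi z) k != 0.
  move=> k0; rewrite -phiD phi_neq0; apply: contraTneq (dU k0) => ->.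
  by rewrite unitr0.
have phit : phi t != 0 by rewrite phi_neq0.
have phiz : phi z != 0.
  by rewrite phi_neq0; apply: contraTneq zU => ->; rewrite unitr0.
have QU := pf_qfac_unit; have WU := pf_den_unit.
have phiW : phi (qfac (z * t) t N.*2 * qfac (t / z) t N.*2)^-1 =
    (qfac (phi z * phi t) (phi t) N.*2 * qfac (phi t / phi z) (phi t) N.*2)^-1.
  by rewrite phiV // [in LHS]rmorphM !phiQ !rmorphM phiV.
have phiN : phi (pfnum t z N) = pfnum (phi t) (phi z) N.
  by rewrite /pfnum rmorphM !phiQ !rmorphN !rmorphM phiV // !rmorphXn.
have phiQQ m n : phi (qfac t t m * qfac t t n)^-1 =
    (qfac (phi t) (phi t) m * qfac (phi t) (phi t) n)^-1.
  by rewrite phiV ?unitrM ?QU // rmorphM !phiQ.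
have phiDD k : phi (pfden t z 0 / pfden t z k.+1) =
    pfden (phi t) (phi z) 0 / pfden (phi t) (phi z) k.+1.
  by rewrite [LHS]rmorphM phiV ?dU // !phiD.
apply: phi_inj; rewrite [LHS]rmorphM phiN phiW (partial_fractions t_free) //.
rewrite [RHS]rmorphD rmorph_sum; congr (_ + _).
  by rewrite rmorphM phiV ?unitrX // !rmorphXn !phiQ rmorphN rmorphXn.
apply: eq_bigr => m _; rewrite [RHS]rmorphD.
rewrite ![phi (_ * (pfden t z 0 / _))]rmorphM !phiDD !rmorphM !phiQQ !phiQ.
by rewrite !rmorphN !rmorphXn rmorph_nat.
Qed.

End IntegralDomain.

(** * Partial fractions of the infinite product *)

Lemma laurent_top (p : laurent) : p != 0 ->
  exists2 m, p m != 0 & forall i, m < i -> p i = 0.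
Proof.
move=> p0; have [S _ pS] := lsupp_seq p.
pose S' := [seq i <- S | p i != 0].
have memS' i : (i \in S') = (p i != 0).
  by rewrite mem_filter; case: eqP => //= /eqP /pS.
have [m0 pm0] : exists m, p m != 0.
  apply: contrapT => /forallNP np; case/eqP: p0; apply: laurentP => m.
  by have /negP := np m; rewrite negbK => /eqP.
have lt0 : (index m0 S' < size S')%N by rewrite index_mem memS'.
case: (arg_maxP (fun i : 'I_(size S') => S'`_i) (erefl : xpredT (Ordinal lt0))).
move=> j _ maxj; exists S'`_j; first by rewrite -memS' mem_nth.
move=> i ltji; apply/eqP; apply: contraTT ltji => pi0; rewrite -leNgt.
have lti : (index i S' < size S')%N by rewrite index_mem memS'.
by have := maxj (Ordinal lti) isT; rewrite /= nth_index // memS'.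
Qed.

Lemma laurent_mulE (p r : laurent) m : (p * r) m = lmul_fun p r m.
Proof. by []. Qed.

(** The coefficient of the product at the sum of the top exponents is the product of the two leading
    coefficients. *)
Lemma laurent_integral (p r : laurent) : p * r = 0 -> (p == 0) || (r == 0).
Proof.
apply: contra_eqT; rewrite negb_or => /andP[/laurent_top[m pm hm] /laurent_top[n rn hn]].
apply/eqP => /(congr1 (fun f : laurent => f (m + n))); rewrite laurent_mulE /=.
have [S uS pS] := lsupp_seq p; rewrite (lmul_funE _ _ uS pS).
rewrite (bigD1_seq m) ?pS //= big1 => [|i ne_im]; last first.
  case: (ltgtP i m) ne_im => // [ltim|/hm ->] _; last by rewrite mul0r.
  by rewrite hn ?mulr0 // addrAC ltrDr subr_gt0.
rewrite addr0 addrAC subrr add0r => /eqP.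
by rewrite mulf_eq0 (negPf pm) (negPf rn).
Qed.

Lemma fps_bottom (R : comNzRingType) (f : fps R) : f != 0 ->
  exists2 n, f n != 0 & vanish n f.
Proof.
move=> f0; have exn : exists n, f n != 0.
  apply: contrapT => /forallNP nf; case/eqP: f0; apply: fpsP => n.
  by have /negP := nf n; rewrite negbK => /eqP.
exists (ex_minn exn); case: ex_minnP => // n fn0 minn i ltin.
by apply/eqP; apply: contraTT ltin => /minn; rewrite -leqNgt.
Qed.

(** Same argument with the lowest powers of q; it makes [partial_fractions_domain] applicable to
    [fps laurent]. *)
Lemma fps_laurent_integral (f g : fps laurent) : f * g = 0 -> (f == 0) || (g == 0).
Proof.
apply: contra_eqT; rewrite negb_or => /andP[/fps_bottom[m fm hm] /fps_bottom[n gn hn]].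
apply/eqP => /(congr1 (fun h : fps laurent => h (m + n)%N)).
rewrite fps_mulE (bigD1 (inord m)) //= big1 => [|i]; last first.
  rewrite -val_eqE /= inordK ?ltnS ?leq_addr // => ne_im.
  case: (ltngtP i m) ne_im => // [/hm ->|ltmi] _; first by rewrite mul0r.
  by rewrite hn ?mulr0 //; have := ltn_ord i; lia.
rewrite inordK ?ltnS ?leq_addr // addr0 addKn => /laurent_integral.
by rewrite (negPf fm) (negPf gn).
Qed.

HB.instance Definition _ :=
  GRing.ComUnitRing_isIntegral.Build (fps laurent) fps_laurent_integral.

Section RankSums.
Variable R : comNzRingType.
Implicit Types t x : fps R.

Definition rank_sum_odd t x := fps_sum (fun m =>
  - t ^+ (m ^ 2 + 3 * m + 1) * (pfden t x 0 / pfden t x m.*2.+1)).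

Definition rank_sum_even t x := fps_sum (fun m =>
  t ^+ (m.+1 ^ 2 + 2 * m.+1) * (pfden t x 0 / pfden t x m.*2.+2)).

Lemma vanish_expr_le t m n : vanish 1 t -> (m <= n)%N -> vanish m (t ^+ n).
Proof. by move=> vt lemn; apply: vanish_le lemn (vanishX vt). Qed.

Lemma one_sub_unit t x k : vanish 1 t -> (0 < k)%N -> 1 - x * t ^+ k \is a GRing.unit.
Proof.
move=> vt k0; apply: fps_unit.
by rewrite fps_addE fps_oppE (vanishMl x (vanish_expr_le vt k0)) // subr0.
Qed.

Lemma pfden_unit t x k : vanish 1 t -> (0 < k)%N -> pfden t x k \is a GRing.unit.
Proof. by move=> vt k0; rewrite unitrM !one_sub_unit. Qed.

End RankSums.

Section FpsPartialFractions.
Variables t z : fps laurent.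
Hypotheses (vt : vanish 1 t) (t_neq0 : t != 0) (zU : z \is a GRing.unit).

(** Termwise limit of [partial_fractions_domain]: the factorials with base [t] tend to [qpoch t t],
    and each pair with base [t ^+ 2] to the square of an infinite product. *)
Lemma product_expansion :
  qpoch2 (- (z * t ^+ 2)) (- (t ^+ 2 / z)) (t ^+ 2) / qpoch2 (z * t) (t / z) t =
  qpoch (- t ^+ 2) (t ^+ 2) ^+ 2 / qpoch t t ^+ 2 *
    (1 + 2 * rank_sum_even t z) +
  qpoch (- t) (t ^+ 2) ^+ 2 / qpoch t t ^+ 2 * rank_sum_odd t z.
Proof.
have v2 : vanish 1 (t ^+ 2) by rewrite expr2; apply: vanishMr.
have vz : vanish 1 (z * t) by apply: vanishMl.
have vz' : vanish 1 (t / z) by apply: vanishMr.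
have t1U k : (0 < k)%N -> 1 - t ^+ k \is a GRing.unit.
  by move=> k0; rewrite -[t ^+ k]mul1r one_sub_unit.
have dU k (k0 : (0 < k)%N) := pfden_unit z vt k0.
have QU n : qfac t t n \is a GRing.unit by apply: qfac_unit.
have QooU : qpoch t t \is a GRing.unit by apply: qpoch_unit.
have lhs : fcvg (fun N => pfnum t z N / (qfac (z * t) t N.*2 * qfac (t / z) t N.*2))
    (qpoch2 (- (z * t ^+ 2)) (- (t ^+ 2 / z)) (t ^+ 2) / qpoch2 (z * t) (t / z) t).
  apply: fcvgM; first by apply: fcvgM; apply: qfac_cvg.
  apply: fcvgV; [by move=> N; rewrite unitrM !qfac_unit| |].
    by rewrite unitrM !qpoch_unit.
  by apply: fcvgM; apply: (fcvg_comp (m := 0)) (qfac_cvg _ vt) => k _; lia.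
apply: fcvg_unique lhs _; apply: eq_fcvg.
  by move=> N; exact: esym (partial_fractions_domain t_neq0 zU t1U dU N).
have cQ m : fcvg (fun N => (qfac t t (N.*2 + m) * qfac t t (N.*2 - m))^-1)
    (qpoch t t ^+ 2)^-1.
  apply: fcvgV; [by move=> N; rewrite unitrM !QU|by rewrite unitrX|].
  by apply: fcvgM; [apply: fcvg_qfac_add|apply: fcvg_qfac_sub].
have cP w m k : (k <= m.+1)%N ->
    fcvg (fun N => qfac w (t ^+ 2) (N + m.+1) * qfac w (t ^+ 2) (N - k))
    (qpoch w (t ^+ 2) ^+ 2).
  move=> _; apply: fcvgM.
    by apply: (fcvg_comp (m := 0)) (qfac_cvg _ v2) => j _; lia.
  by apply: (fcvg_comp (m := k)) (qfac_cvg _ v2) => j _; lia.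
rewrite mulrDr mulr1 -addrA; apply: fcvgD.
  apply: fcvgM; first by apply: fcvgM; apply: qfac_cvg.
  by apply: eq_fcvg (cQ 0%N) => N; rewrite addn0 subn0 expr2.
under eq_fun do rewrite big_split /=.
rewrite addrC; apply: fcvgD.
  rewrite -fps_sumZ; last first.
    by move=> m; apply/vanishMr/vanishN/(vanish_expr_le vt); nia.
  (* The power of [t] alone gives the uniform bound, since [k <= k ^ 2 + 3 k + 1]. *)
  apply: (fcvg_Tannery (b := id)) => // [N k|k].
    by do 3!apply: vanishMr; apply/vanishN/(vanish_expr_le vt); nia.
  rewrite mulrA; apply: fcvgM (fcvg_cst _).
  rewrite mulrC mulrA; apply: fcvgM (cQ _).
  by apply: fcvgM (fcvg_cst _) (cP _ _ _ _).
rewrite mulrA -fps_sumZ; last first.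
  by move=> m; apply/vanishMr/(vanish_expr_le vt); nia.
apply: (fcvg_Tannery (b := id)) => // [N k|k].
  by do 3!apply: vanishMr; apply/(vanish_expr_le vt); nia.
rewrite mulrA; apply: fcvgM (fcvg_cst _).
rewrite mulrC mulrAC mulrA mulrA; apply: fcvgM (cQ _).
rewrite -mulrA [_ * 2]mulrC.
by apply: fcvgM (fcvg_cst _) (fcvgM (fcvg_cst _) (cP _ _ _ _)).
Qed.

End FpsPartialFractions.

(** * The 2-dissection *)

Section Overpartition.
Variable R : comNzRingType.
Implicit Types t : fps R.

(** Here [o], [d], [b], [c] stand for [(- t; t ^ 2)], [(- t ^ 2; t ^ 2)], [(t; t)] and
    [(t ^ 2; t ^ 2)], all infinite. *)
Lemma overpartition_algebra (A : comUnitRingType) (o d b c : A) :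
  b \is a GRing.unit -> c \is a GRing.unit -> o * d * b = c ->
  o * d / b = o ^+ 2 * c * ((d * c) ^+ 2 / c ^+ 4).
Proof.
move=> bU cU e; apply: (canLR (mulrK bU)).
have -> : o ^+ 2 * c * ((d * c) ^+ 2 / c ^+ 4) * b =
    o * d * (o * d * b) * c ^+ 3 / c ^+ 4 by ring.
rewrite e (_ : _ / _ = o * d * (c ^+ 4 / c ^+ 4)); last by ring.
by rewrite mulrV ?mulr1 // unitrX.
Qed.

(** From [phi (t) phi (- t) = phi (- t ^ 2) ^ 2] the left side [1 / phi (- t)] is [phi (t)] over an
    even series; only [phi (t)] is left to dissect. *)
Lemma overpartition_dissection t : vanish 1 t -> GRing.lreg t ->
  qpoch (- t) t / qpoch t t =
  (qpoch (- t ^+ 4) (t ^+ 8) ^+ 2 * qpoch (t ^+ 8) (t ^+ 8) +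
   t * (2 * qpoch (- t ^+ 8) (t ^+ 8) ^+ 2 * qpoch (t ^+ 8) (t ^+ 8))) *
  (qpoch (t ^+ 4) (t ^+ 4) ^+ 2 / qpoch (t ^+ 2) (t ^+ 2) ^+ 4).
Proof.
move=> vt treg; have vt2 : vanish 1 (t ^+ 2) by rewrite expr2; apply: vanishMr.
rewrite -(theta3_dissection vt treg).
have e4 : (t ^+ 2) ^+ 2 = t ^+ 4 by rewrite -exprM.
have := qpoch_opp_mul vt2; rewrite e4 => <-.
have ab := qpoch_opp_mul vt; have ao := qpoch_even_odd (- t) vt.
rewrite [- t * t]mulNr -expr2 in ao.
rewrite ao in ab *; apply: overpartition_algebra => //; exact: qpoch_unit.
Qed.

End Overpartition.

(** * Even series and odd parts *)

Section Parity.
Variable R : comNzRingType.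
Implicit Types (f g w s : fps R) (u : nat -> fps R).

(* the substitution q := - q *)
Definition fps_alt f : fps R := Fps (fun n => (-1) ^+ n * f n).

Lemma fps_alt_zmod : zmod_morphism fps_alt.
Proof.
by move=> f g; apply: fpsP => n; apply: mulrBr.
Qed.

Lemma fps_alt_monoid : monoid_morphism fps_alt.
Proof.
split=> [|f g]; apply: fpsP => n.
  by case: n => [|n]; [apply: mul1r | apply: mulr0].
transitivity ((-1) ^+ n * \sum_(i < n.+1) f i * g (n - i)%N); first by [].
rewrite [RHS]fps_mulE mulr_sumr; apply: eq_bigr => i _ /=.
have {1}-> : n = (i + (n - i))%N by rewrite subnKC // -ltnS.
by rewrite exprD; ring.
Qed.

HB.instance Definition _ := GRing.isZmodMorphism.Build _ _ fps_alt fps_alt_zmod.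
HB.instance Definition _ := GRing.isMonoidMorphism.Build _ _ fps_alt fps_alt_monoid.

Lemma vanish_alt n f : vanish n f -> vanish n (fps_alt f).
Proof. by move=> vf i lti /=; rewrite vf ?mulr0. Qed.

Lemma fcvg_alt u f : fcvg u f -> fcvg (fun k => fps_alt (u k)) (fps_alt f).
Proof.
move=> uf n; have [N hN] := uf n; exists N => k /hN vk.
by rewrite -rmorphB; apply: vanish_alt.
Qed.

(** Evenness as invariance under a ring morphism, so that it passes to products, inverses and limits
    at once. *)
Definition fps_even f := fps_alt f = f.

Lemma fps_evenD f g : fps_even f -> fps_even g -> fps_even (f + g).
Proof. by rewrite /fps_even => ef eg; rewrite rmorphD /= ef eg. Qed.

Lemma fps_evenN f : fps_even f -> fps_even (- f).
Proof. by rewrite /fps_even => ef; rewrite rmorphN /= ef. Qed.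

Lemma fps_evenM f g : fps_even f -> fps_even g -> fps_even (f * g).
Proof. by rewrite /fps_even => ef eg; rewrite rmorphM /= ef eg. Qed.

Lemma fps_even1 : fps_even 1.
Proof. exact: rmorph1. Qed.

Lemma fps_even_nat n : fps_even n%:R.
Proof. exact: rmorph_nat. Qed.

Lemma fps_evenX f n : fps_even f -> fps_even (f ^+ n).
Proof. by rewrite /fps_even => ef; rewrite rmorphXn /= ef. Qed.

Lemma fps_evenV f : f \is a GRing.unit -> fps_even f -> fps_even f^-1.
Proof. by rewrite /fps_even => fU ef; rewrite rmorphV //= ef. Qed.

Lemma fps_even_limit u f : (forall n, fps_even (u n)) -> fcvg u f -> fps_even f.
Proof.
move=> eu uf; apply: fcvg_unique (fcvg_alt uf) _.
by apply: eq_fcvg uf => n; rewrite eu.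
Qed.

Lemma fps_even_sum (F : nat -> fps R) : (forall n, vanish n (F n)) ->
  (forall n, fps_even (F n)) -> fps_even (fps_sum F).
Proof.
move=> vF eF; apply: fps_even_limit (fcvg_sum vF) => N.
by apply: big_ind => //; [exact: rmorph0 | exact: fps_evenD].
Qed.

Lemma fps_even_qpoch w s : vanish 1 s -> fps_even w -> fps_even s ->
  fps_even (qpoch w s).
Proof.
move=> vs ew es; apply: fps_even_limit (qfac_cvg w vs) => n.
apply: big_ind => [||i _]; [exact: fps_even1 | exact: fps_evenM |].
exact/(fps_evenD fps_even1)/fps_evenN/fps_evenM/fps_evenX.
Qed.

Lemma fps_even_C (c : R) : fps_even (fpsC c).
Proof. by apply: fpsP => -[|n] /=; rewrite ?mul1r ?mulr0. Qed.

Lemma fpsX_mulS f n : (fpsX R * f) n.+1 = f n.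
Proof.
rewrite fps_mulE big_ord_recl /= mul0r add0r big_ord_recl /= mul1r subSS subn0.
by rewrite big1 ?addr0 // => i _; rewrite /= mul0r.
Qed.

Lemma fpsX_mul0 f : (fpsX R * f) 0%N = 0.
Proof. by rewrite fps_mul0E mul0r. Qed.

Lemma fpsX_lreg : GRing.lreg (fpsX R).
Proof. by move=> f g /= e; apply: fpsP => n; rewrite -(fpsX_mulS f) -(fpsX_mulS g) e. Qed.

Lemma vanish_fpsX : vanish 1 (fpsX R).
Proof. by case. Qed.

Lemma fps_altX : fps_alt (fpsX R) = - fpsX R.
Proof.
apply: fpsP => n; rewrite fps_oppE /=.
by case: (eqVneq n 1%N) => [->|_]; rewrite ?mulr0 ?oppr0 // expr1 mulN1r.
Qed.

Lemma fps_even_X2 n : fps_even (fpsX R ^+ (2 * n)).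
Proof. by rewrite /fps_even rmorphXn /= fps_altX exprM sqrrN -exprM. Qed.

Lemma fpsC_mulX_E (c : R) m n : (fpsC c * fpsX R ^+ m) n = if n == m then c else 0.
Proof.
rewrite mulrC; elim: m n => [|m IHm] n; first by rewrite mul1r.
rewrite exprS -mulrA; case: n => [|n]; first by rewrite fpsX_mul0.
by rewrite fpsX_mulS IHm.
Qed.

(** Invariance only yields [c = - c] for the odd coefficients of an even series, hence the
    hypothesis on [R]; the odd coefficients of [f] are then those of the second summand. *)
Lemma fps_odd_part f g h : (forall c : R, c = - c -> c = 0) ->
  f = g + fpsX R * h -> fps_even g -> fps_even h ->
  fps_sum (fun n => fpsC (f (2 * n + 1)%N) * fpsX R ^+ (2 * n + 1)) = fpsX R * h.
Proof.
move=> no2 fE eg eh.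
have odd0 p n : fps_even p -> odd n -> p n = 0.
  move=> ep on; apply: no2; rewrite -[in LHS]ep /= -signr_odd on expr1 mulN1r.
  by [].
have fo n : odd n -> f n = (fpsX R * h) n.
  by move=> on; rewrite fE fps_addE (odd0 g) // add0r.
have ev n : ~~ odd n -> (fpsX R * h) n = 0.
  case: n => [|n] en; first by rewrite fpsX_mul0.
  by rewrite fpsX_mulS (odd0 h) //; move: en; rewrite /= negbK.
(* Only the term of index [i./2] can contribute to the coefficient [i], and it is present once
   [i < k]. *)
apply: fps_limE => i; exists i.+1 => k lek; rewrite fps_sumE.
under eq_bigr do rewrite fpsC_mulX_E.
case: (boolP (odd i)) => [oi|ei]; last first.
  rewrite ev // big1 // => j _; case: eqP => // ij; case/negP: ei.
  by rewrite ij oddD oddM.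
rewrite big_mkord.
have lti : (i./2 < k)%N by lia.
rewrite (bigD1 (Ordinal lti)) //= big1 => [|j].
  rewrite addr0; have -> : (2 * i./2 + 1 = i)%N by lia.
  by rewrite eqxx fo.
by rewrite -val_eqE /= => ne; case: eqP => // ij; lia.
Qed.

End Parity.

(** * Laurent polynomials as constant series *)

Section LaurentCoefficients.

Lemma fpsC_zmod (R : comNzRingType) : zmod_morphism (@fpsC R).
Proof. by move=> a b; apply: fpsP => -[|n] //; exact: esym (subrr 0). Qed.

Lemma fpsC_monoid (R : comNzRingType) : monoid_morphism (@fpsC R).
Proof.
split=> // a b; apply: fpsP => n; rewrite fps_mulE.
case: n => [|n]; first by rewrite big_ord1.
by rewrite big1 // => -[[|i] lti] _; rewrite ?mulr0 ?mul0r.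
Qed.

HB.instance Definition _ (R : comNzRingType) :=
  GRing.isZmodMorphism.Build _ _ (@fpsC R) (@fpsC_zmod R).
HB.instance Definition _ (R : comNzRingType) :=
  GRing.isMonoidMorphism.Build _ _ (@fpsC R) (@fpsC_monoid R).

Lemma lmonoD i j : lmono (i + j) = lmono i * lmono j.
Proof.
apply: laurentP => m; rewrite laurent_mulE (@lmul_funE _ _ [:: i]) //.
  by rewrite big_seq1 /= eqxx mul1r [i + j]addrC -[RHS]/((_ == _)%:Z) subr_eq.
by move=> k; rewrite inE /=; case: (k == i).
Qed.

Lemma lmono_expn n : lmono 1 ^+ n = lmono n%:Z.
Proof. by elim: n => // n IHn; rewrite exprS IHn -lmonoD; congr lmono; lia. Qed.

Lemma z_inv : fpsC (lmono (-1)) * z = 1.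
Proof. by rewrite -rmorphM -lmonoD addNr rmorph1. Qed.

Lemma z_unit : z \is a GRing.unit.
Proof. by apply/unitrPr; exists (fpsC (lmono (-1))); rewrite mulrC z_inv. Qed.

Lemma z_expz (m : int) : z ^ m = fpsC (lmono m).
Proof.
case: m => n; first by rewrite -[LHS]/(z ^+ n) -rmorphXn /= lmono_expn.
rewrite -[LHS]/((z ^+ n.+1)^-1); apply: (mulrI (unitrX n.+1 z_unit)).
rewrite mulrV ?unitrX ?z_unit // -rmorphXn -rmorphM lmono_expn -lmonoD.
by rewrite NegzE subrr rmorph1.
Qed.

Lemma lcoef_sum (I : Type) (r : seq I) (F : I -> laurent) m :
  (\sum_(i <- r) F i) m = \sum_(i <- r) F i m.
Proof. by elim/big_rec2: _ => // i x y _ <-. Qed.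

Lemma lcoef_mulrn (p : laurent) n m : (p *+ n) m = p m *+ n.
Proof. by elim: n => // n IHn; rewrite !mulrS -IHn. Qed.

Lemma lcoef_intM (k : int) (p : laurent) m : (k%:~R * p) m = k * p m.
Proof.
rewrite mulrzl; case: k => n; first by rewrite -[p *~ _]/(p *+ n) lcoef_mulrn -mulr_natl natz.
rewrite NegzE mulrNz -[LHS]/(- ((p *+ n.+1) m)) lcoef_mulrn.
by rewrite -mulr_natl natz mulNr.
Qed.

(** A Laurent polynomial is the sum of its monomials; finiteness of its support gives the sum over
    all integers its meaning. *)
Lemma laurent_expansion (p : laurent) (g : fps laurent) :
  \sum_(m \in [set: int]) (p m)%:~R * z ^ m * g = fpsC p * g.
Proof.
have [S uS pS] := lsupp_seq p.
transitivity (\sum_(m <- S) (p m)%:~R * z ^ m * g).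
  rewrite (fsbig_seq _ _ uS); symmetry; apply: fsbig_widen => //.
  move=> m [_] /= mS; case: (eqVneq (p m) 0) => [->|/pS //].
  by rewrite mulr0z !mul0r.
rewrite -mulr_suml; congr (_ * _).
under eq_bigr do rewrite z_expz -(rmorph_int (@fpsC laurent)) -rmorphM.
rewrite -rmorph_sum; congr fpsC; apply: laurentP => i; rewrite lcoef_sum.
under eq_bigr do rewrite lcoef_intM.
case: (boolP (i \in S)) => [iS|iNS].
  rewrite (bigD1_seq i) //= eqxx mulr1 big1 ?addr0 // => j ne_ji.
  by rewrite eq_sym (negPf ne_ji) mulr0.
rewrite big1_seq => [|j /= jS]; first by apply/esym/eqP; apply: contraNT iNS => /pS.
by case: eqP => [ij|_]; rewrite ?mulr0 //; case/negP: iNS; rewrite ij.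
Qed.

Lemma laurent_no2 (p : laurent) : p = - p -> p = 0.
Proof.
move=> e; apply: laurentP => m; have : p m = - p m by rewrite {1}e.
by move=> pm; transitivity (0 : int); first lia.
Qed.

End LaurentCoefficients.

Section Terms.
Variable R : comNzRingType.
Implicit Types t x : fps R.

Lemma pfden_even t x k : x \is a GRing.unit -> fps_even t -> fps_even x ->
  fps_even (pfden t x k).
Proof.
move=> xU et ex; have e1 := fps_even1 R.
apply: fps_evenM; apply: fps_evenD => //; apply: fps_evenN.
  exact/fps_evenM/fps_evenX.
by apply: fps_evenM; [exact: fps_evenV | exact: fps_evenX].
Qed.

Lemma rank_sum_odd_even t x : x \is a GRing.unit -> vanish 1 t ->
  fps_even t -> fps_even x -> fps_even (rank_sum_odd t x).
Proof.
move=> xU vt et ex; apply: fps_even_sum => m.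
  by apply/vanishMr/vanishN/(vanish_expr_le vt); nia.
apply: fps_evenM; first exact/fps_evenN/fps_evenX.
apply: fps_evenM; first exact: pfden_even.
by apply: fps_evenV; [exact: pfden_unit | exact: pfden_even].
Qed.

Lemma rank_sum_even_even t x : x \is a GRing.unit -> vanish 1 t ->
  fps_even t -> fps_even x -> fps_even (rank_sum_even t x).
Proof.
move=> xU vt et ex; apply: fps_even_sum => m.
  by apply/vanishMr/(vanish_expr_le vt); nia.
apply: fps_evenM; first exact: fps_evenX.
apply: fps_evenM; first exact: pfden_even.
by apply: fps_evenV; [exact: pfden_unit | exact: pfden_even].
Qed.

End Terms.

(** * The terms of the rank sum and the final algebra *)

Section RankTerm.
Variable A : comUnitRingType.
Implicit Types s x : A.

Definition rank_term s x n :=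
  (1 - x) * (1 - x^-1) * (-1) ^+ n * s ^+ (n ^ 2 + 4 * n) /
    ((1 - x * s ^+ (4 * n)) * (1 - x^-1 * s ^+ (4 * n))).

Lemma rank_term_even s x m : rank_term s x m.*2.+2 =
  (s ^+ 4) ^+ (m.+1 ^ 2 + 2 * m.+1) *
    (pfden (s ^+ 4) x 0 / pfden (s ^+ 4) x m.*2.+2).
Proof.
rewrite /rank_term /pfden -!exprM muln0 expr0 !mulr1 -signr_odd /= odd_double mulr1.
have -> : (m.*2.+2 ^ 2 + 4 * m.*2.+2 = 4 * (m.+1 ^ 2 + 2 * m.+1))%N by lia.
by rewrite mulrAC mulrC.
Qed.

Lemma rank_term_odd s x m : rank_term s x m.*2.+1 =
  s * (- (s ^+ 4) ^+ (m ^ 2 + 3 * m + 1) *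
    (pfden (s ^+ 4) x 0 / pfden (s ^+ 4) x m.*2.+1)).
Proof.
rewrite /rank_term /pfden -!exprM muln0 expr0 !mulr1 -signr_odd /= odd_double expr1.
have -> : (m.*2.+1 ^ 2 + 4 * m.*2.+1 = (4 * (m ^ 2 + 3 * m + 1)).+1)%N by lia.
rewrite mulrN1 exprS !mulNr !mulrN mulrA; congr (- _).
by rewrite mulrAC [in LHS]mulrC mulrA.
Qed.

(** The hypothesis on [x / y] is [product_expansion] at [t = q ^ 4], and the left side is the odd
    part delivered by [parity_split]: the two combinations of the rank sums agree up to a factor. *)
Lemma odd_part_algebra s (o e2 r8 q4 c2 dd ee x y : A) :
  y \is a GRing.unit -> q4 \is a GRing.unit -> c2 \is a GRing.unit ->
  x / y = e2 ^+ 2 / q4 ^+ 2 * (1 + 2 * ee) + o ^+ 2 / q4 ^+ 2 * dd ->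
  s * ((o ^+ 2 * r8) * (q4 ^+ 2 / c2 ^+ 4) * (2 * dd) +
       2 * e2 ^+ 2 * r8 * (q4 ^+ 2 / c2 ^+ 4) * (1 + 2 * ee)) =
  2 * s * x * q4 ^+ 4 * r8 / (y * c2 ^+ 4).
Proof.
move=> yU qU cU xy.
rewrite [(y * _)^-1]invrM ?unitrX //.
rewrite [RHS](_ : _ = 2 * s * (x / y) * q4 ^+ 4 * r8 / c2 ^+ 4); last by ring.
rewrite xy; have qV : q4 ^+ 2 / q4 ^+ 2 = 1 by rewrite mulrV ?unitrX.
rewrite [RHS](_ : _ = 2 * s * (e2 ^+ 2 * (q4 ^+ 2 / q4 ^+ 2) * (1 + 2 * ee) +
  o ^+ 2 * (q4 ^+ 2 / q4 ^+ 2) * dd) * q4 ^+ 2 * r8 / c2 ^+ 4); last by ring.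
by rewrite qV; ring.
Qed.

End RankTerm.

Lemma overrank4E : overrank 4 = qpoch (- q) q / qpoch q q *
  (1 + 2 * fps_sum (fun n => rank_term q z n.+1)).
Proof. by []. Qed.

Lemma q_neq0 : q != 0.
Proof.
apply/eqP => /(congr1 (fun f : fps laurent => f 1%N)) /eqP.
by rewrite oner_eq0.
Qed.

Lemma sum_rank_term :
  fps_sum (fun n => rank_term q z n.+1) =
  q * rank_sum_odd (q ^+ 4) z + rank_sum_even (q ^+ 4) z.
Proof.
have vq : vanish 1 q := @vanish_fpsX laurent.
have vq4 : vanish 1 (q ^+ 4) := vanish_expr_le vq (isT : (1 <= 4)%N).
rewrite fps_sum_even_odd => [|n]; last first.
  by apply/vanishMr/vanishMl/(vanish_le _ (vanishX vq)); nia.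
rewrite -[q * rank_sum_odd _ _]fps_sumZ => [|m]; last first.
  by apply/vanishMr/vanishN/(vanish_le _ (vanishX vq4)); nia.
congr (fps_sum _ + fps_sum _); apply/funext => m.
  exact: rank_term_odd.
exact: rank_term_even.
Qed.

Lemma lhs_odd_part (f : fps laurent) :
  fps_sum (fun n : nat => \sum_(m \in [set: int])
    (f (2 * n + 1)%N m)%:~R * z ^ m * q ^+ (2 * n + 1)%N) =
  fps_sum (fun n => fpsC (f (2 * n + 1)%N) * fpsX laurent ^+ (2 * n + 1)).
Proof. by congr fps_sum; apply/funext => n; exact: laurent_expansion. Qed.

(** With [s = q], [a = phi (q ^ 4)], [b = 2 psi (q ^ 8)] and all letters but [s] even in q, the last
    line is the odd part. *)
Lemma parity_split (A : comNzRingType) (s a b v d e : A) :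
  (a + s * b) * v * (1 + 2 * (s * d + e)) =
  a * v * (1 + 2 * e) + s ^+ 2 * (b * v * (2 * d)) +
  s * (a * v * (2 * d) + b * v * (1 + 2 * e)).
Proof. by ring. Qed.

Theorem theorem8p1 :
  fps_sum (fun n : nat => \sum_(m \in [set: int])
    (M 4 m (2 * n + 1)%N)%:~R * z ^ m * q ^+ (2 * n + 1)%N) =
  2 * q * qpoch2 (- (z * q ^+ 8)) (- (q ^+ 8 / z)) (q ^+ 8)
    * qpoch (q ^+ 4) (q ^+ 4) ^+ 4 * qpoch (q ^+ 8) (q ^+ 8)
  / (qpoch2 (z * q ^+ 4) (q ^+ 4 / z) (q ^+ 4) * qpoch (q ^+ 2) (q ^+ 2) ^+ 4).
Proof.
have vX k : (0 < k)%N -> vanish 1 (q ^+ k).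
  by move=> k0; apply: vanish_le k0 (vanishX (@vanish_fpsX laurent)).
have eX k : fps_even (q ^+ (2 * k)) := @fps_even_X2 laurent k.
have e2 := eX 1%N; have e4 := eX 2%N; have e8 := eX 4%N.
have ez : fps_even z := @fps_even_C laurent _.
have v2 := vX 2%N isT; have v4 := vX 4%N isT; have v8 := vX 8%N isT.
apply: etrans (lhs_odd_part (overrank 4)) _.
have := product_expansion v4 (expf_neq0 4 q_neq0) z_unit.
have := sum_rank_term; have := overrank4E.
rewrite (overpartition_dissection (@vanish_fpsX laurent) (@fpsX_lreg laurent)).
have q48 : (q ^+ 4) ^+ 2 = q ^+ 8 by rewrite -exprM.
rewrite q48.
have cU : qpoch (q ^+ 2) (q ^+ 2) \is a GRing.unit by exact: qpoch_unit.
have qU : qpoch (q ^+ 4) (q ^+ 4) \is a GRing.unit by exact: qpoch_unit.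
have yU : qpoch2 (z * q ^+ 4) (q ^+ 4 / z) (q ^+ 4) \is a GRing.unit.
  by rewrite unitrM !qpoch_unit //; [apply: vanishMr | apply: vanishMl].
have eo : fps_even (qpoch (- q ^+ 4) (q ^+ 8)).
  exact: fps_even_qpoch v8 (fps_evenN e4) e8.
have ee2 : fps_even (qpoch (- q ^+ 8) (q ^+ 8)).
  exact: fps_even_qpoch v8 (fps_evenN e8) e8.
have er8 := fps_even_qpoch v8 e8 e8.
have eq4 := fps_even_qpoch v4 e4 e4.
have ec2 := fps_even_qpoch v2 e2 e2.
have edd := rank_sum_odd_even z_unit v4 e4 ez.
have eee := rank_sum_even_even z_unit v4 e4 ez.
(* From here on only the parity of the two rank sums and the relations [O], [S], [X] matter. *)
move: (rank_sum_odd _ _) (rank_sum_even _ _) edd eee => dd ee edd eee.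
move=> O S X; rewrite S in O; rewrite parity_split in O.
have e12 : fps_even (1 + 2 * ee).
  apply: fps_evenD; first exact: fps_even1.
  by apply: fps_evenM eee; exact: fps_even_nat.
have e2d : fps_even (2 * dd) by apply: fps_evenM edd; exact: fps_even_nat.
have ev := fps_evenM (fps_evenX 2 eq4) (fps_evenV (unitrX 4 cU) (fps_evenX 4 ec2)).
have ea := fps_evenM (fps_evenX 2 eo) er8.
have eb := fps_evenM (fps_evenM (fps_even_nat laurent 2) (fps_evenX 2 ee2)) er8.
(* It remains to recognise the odd part of [O] and to check that both brackets of the splitting are
   even. *)
apply: etrans (odd_part_algebra q _ yU qU cU X).
apply: (fps_odd_part laurent_no2 O).
  apply: fps_evenD; first exact: fps_evenM (fps_evenM ea ev) e12.
  exact: fps_evenM e2 (fps_evenM (fps_evenM eb ev) e2d).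
apply: fps_evenD; first exact: fps_evenM (fps_evenM ea ev) e2d.
exact: fps_evenM (fps_evenM eb ev) e12.
Qed.
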